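(* Let $G$ be a compact connected Lie group whose Lie algebra $\mathfrak g$ carries an $\mathrm{Ad}$-invariant inner product $\langle\cdot,\cdot\rangle$, acting on itself by conjugation, and let $\eta\in\Omega^3(G)$ be the Cartan $3$-form. Let $M$ be a $G$-manifold, $\omega\in\Omega^2(M)^G$, and $\mu\colon M\to G$ equivariant. Define $$\mathrm M\colon\mathfrak g\to\Omega^1(\mu)=\Omega^1(G)\oplus\Omega^0(M),\qquad \mathrm M(x):=\Bigl(\tfrac12\langle\theta^L+\theta^R,x\rangle,\,0\Bigr).$$ Then $(M,\omega,\mu)$ satisfies both (QH1) $d\omega=\mu^*\eta$, and (QH2) $\iota_{v_x}\omega=\tfrac12\mu^*\langle\theta^L+\theta^R,x\rangle$ for all $x\in\mathfrak g$, if and only if $\varpi_G:=(\eta,\omega)-\mathrm M$ is a one-step extension of $\varpi=(\eta,\omega)$ in the relative Cartan model $C_G(\mu)$, i.e. if and only if $d_G^\mu\varpi_G=0$.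
   Context: All manifolds, maps, forms and actions are smooth. $\theta^L,\theta^R\in\Omega^1(G;\mathfrak g)$ are the left- and right-invariant Maurer–Cartan forms; $\eta=\tfrac1{12}\langle\theta^L,[\theta^L,\theta^L]\rangle$. Fundamental vector fields: $v_x|_p=\frac{d}{dt}|_{t=0}\exp(-tx)\cdot p$. $\Omega^k(\mu)=\Omega^k(G)\oplus\Omega^{k-1}(M)$, $d_\mu(\alpha,\beta)=(d\alpha,\mu^*\alpha-d\beta)$. Relative Cartan model: for a $G$-manifold $P$, $C_G^k(P)=\bigoplus_{2p+q=k}(S^p\mathfrak g^\vee\otimes\Omega^q(P))^G$ ($G$-equivariant polynomial maps $\mathfrak g\to\Omega(P)$), $(d_G\alpha)(x)=d(\alpha(x))-\iota_{v_x}(\alpha(x))$; $C_G(\mu)^k=C_G^k(G)\oplus C_G^{k-1}(M)$, with $G$ acting on $G$ by conjugation, and $d_G^\mu(\alpha,\beta)=(d_G\alpha,\,\mu^*\alpha-d_G\beta)$. A one-step extension of $\varpi\in\Omega^3(\mu)$ is a $d_G^\mu$-cocycle $\varpi-\mathrm M\in C_G(\mu)^3$ with $\mathrm M\in(\mathfrak g^\vee\otimes\Omega^1(\mu))^G$. *)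

(* Defs.v *)
From HB Require Import structures.
From mathcomp Require Import all_boot all_order all_algebra.
From mathcomp Require Import all_classical all_reals all_analysis.
Import Order.TTheory GRing.Theory Num.Theory numFieldNormedType.Exports.

Set Implicit Arguments.
Unset Strict Implicit.
Unset Printing Implicit Defensive.

Local Open Scope classical_set_scope.
Local Open Scope ring_scope.

(* C^k on an open set U, by recursion on k: f is C^(k+1) iff it is
   differentiable and all its directional derivatives are C^k. *)
Fixpoint Ck_on (R : realType) (V W : normedModType R) (k : nat)
    (U : set V) (f : V -> W) : Prop :=
  match k with
  | 0%N => forall x, U x -> {for x, continuous f}
  | k'.+1 => (forall x, U x -> differentiable f x) /\
             (forall v, Ck_on k' U (fun x => 'D_v f x))
  end.

Definition smooth_on (R : realType) (V W : normedModType R)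
    (U : set V) (f : V -> W) : Prop := forall k, Ck_on k U f.

(* [cparam] is meaningful only on the image of the chart, [ccoord] only on its
   domain. *)
Record chart (R : realType) (T : topologicalType) (n : nat) := Chart {
  cdom : set T;
  ccoord : T -> 'rV[R]_n;
  cparam : 'rV[R]_n -> T;
  cdom_open : open cdom;
  cimage_open : open (ccoord @` cdom);
  coord_continuous : forall p, cdom p -> {for p, continuous ccoord};
  param_continuous : forall y, (ccoord @` cdom) y -> {for y, continuous cparam};
  coordK : forall p, cdom p -> cparam (ccoord p) = p
}.

(* [chart_at p] is a preferred chart around p; it is used to identify every
   tangent space T_p with R^n: a row vector v stands for the tangent vector at p
   whose components in the coordinates of [chart_at p] are v. *)
Record manifold (R : realType) := Manifold {
  mcarrier :> topologicalType;
  mdim : nat;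
  atlas : set (chart R mcarrier mdim);
  chart_at : mcarrier -> chart R mcarrier mdim;
  manifold_hausdorff : hausdorff_space mcarrier;
  manifold_second_countable : @second_countable mcarrier;
  chart_at_atlas : forall p, atlas (chart_at p);
  chart_at_dom : forall p, cdom (chart_at p) p;
  transition_smooth : forall c c', atlas c -> atlas c' ->
    smooth_on (ccoord c @` (cdom c `&` cdom c')) (ccoord c' \o cparam c)
}.

Section Calculus.
Context {R : realType}.
Implicit Types P Q N : manifold R.

Definition smooth P Q (f : P -> Q) : Prop :=
  continuous f /\
  forall c c', atlas c -> atlas c' ->
    smooth_on (ccoord c @` (cdom c `&` f @^-1` cdom c'))
              (ccoord c' \o f \o cparam c).

(* Smoothness of P * Q -> N, read in the product charts of P * Q. *)
Definition smooth2 P Q N (f : P -> Q -> N) : Prop :=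
  continuous (fun z : P * Q => f z.1 z.2) /\
  forall (c : chart R P (mdim P)) (c' : chart R Q (mdim Q))
         (c'' : chart R N (mdim N)), atlas c -> atlas c' -> atlas c'' ->
    smooth_on
      [set z : 'rV[R]_(mdim P) * 'rV[R]_(mdim Q) |
         [/\ (ccoord c @` cdom c) z.1, (ccoord c' @` cdom c') z.2 &
             cdom c'' (f (cparam c z.1) (cparam c' z.2))]]
      (fun z => ccoord c'' (f (cparam c z.1) (cparam c' z.2))).

Definition smooth_curve P (gamma : R -> P) : Prop :=
  continuous gamma /\
  forall c, atlas c ->
    smooth_on (gamma @^-1` cdom c) (fun t : R^o => ccoord c (gamma t)).

(* d/dt at t = 0 of gamma t, an element of T_(gamma 0) P. *)
Definition velocity0 P (gamma : R -> P) : 'rV[R]_(mdim P) :=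
  'D_(1 : R^o) (fun t : R^o => ccoord (chart_at (gamma 0)) (gamma t)) 0.

(* The differential T_p P -> T_(f p) Q of f at p. *)
Definition tangent_map P Q (f : P -> Q) (p : P) (v : 'rV[R]_(mdim P)) :
    'rV[R]_(mdim Q) :=
  'D_v (ccoord (chart_at (f p)) \o f \o cparam (chart_at p))
       (ccoord (chart_at p) p).

(* W-valued mixed forms.  The component of degree k of [a] at p is the
   restriction of [a p] to lists of k tangent vectors at p; sums, d, pullback
   and contraction act on all degrees at once.  Being an actual smooth
   alternating form is the predicate [is_form] below. *)
Definition vform P (W : Type) : Type := P -> seq 'rV[R]_(mdim P) -> W.
Definition mform P : lmodType R := P -> seq 'rV[R]_(mdim P) -> R^o.

Definition del (T : Type) (i : nat) (s : seq T) : seq T :=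
  take i s ++ drop i.+1 s.

Definition in_chart P (c : chart R P (mdim P)) (a : mform P)
    (y : 'rV[R]_(mdim P)) (s : seq 'rV[R]_(mdim P)) : R^o :=
  a (cparam c y)
    [seq 'D_v (ccoord (chart_at (cparam c y)) \o cparam c) y | v <- s].

Definition is_form P (k : nat) (a : mform P) : Prop :=
  [/\ forall p s, size s != k -> a p s = 0,
      forall p s1 s2 (r : R) u v, (size s1 + size s2).+1 = k ->
        a p (s1 ++ (r *: u + v) :: s2) =
        r * a p (s1 ++ u :: s2) + a p (s1 ++ v :: s2),
      forall p s1 s2 s3 u, a p (s1 ++ u :: s2 ++ u :: s3) = 0 &
      forall c s, atlas c -> size s = k ->
        smooth_on (ccoord c @` cdom c) (fun y => in_chart c a y s)].

Definition pullback P Q (f : P -> Q) (a : mform Q) : mform P :=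
  fun p s => a (f p) (map (tangent_map f p) s).

Definition iprod P (X : P -> 'rV[R]_(mdim P)) (a : mform P) : mform P :=
  fun p s => a p (X p :: s).

(* (da)(v_0, .., v_k) = sum_i (-1)^i D_(v_i) a(v_0, .., ^v_i, .., v_k), in the
   coordinates of [chart_at p], with the v_i extended as constant fields. *)
Definition extd P (a : mform P) : mform P :=
  fun p s => let c := chart_at p in
    \sum_(i < size s)
      (-1) ^+ i * 'D_(nth 0 s i) (fun y => in_chart c a y (del i s)) (ccoord c p).

Definition form1 P (W : zmodType) (a : P -> 'rV[R]_(mdim P) -> W) : vform P W :=
  fun p s => if s is [:: v] then a p v else 0.

(* Wedge product of a 1-form [a] with a form [b], with values combined by B,
   normalised by (a /\ b)(u, v) = B (a u) (b v) - B (a v) (b u). *)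
Definition wedge1 P (W1 W2 : Type) (W : lmodType R) (B : W1 -> W2 -> W)
    (a : P -> 'rV[R]_(mdim P) -> W1) (b : vform P W2) : vform P W :=
  fun p s => \sum_(i < size s)
    (-1) ^+ i *: B (a p (nth 0 s i)) (b p (del i s)).

End Calculus.

Record lieGroup (R : realType) := LieGroup {
  lie_manifold :> manifold R;
  gmul : lie_manifold -> lie_manifold -> lie_manifold;
  ginv : lie_manifold -> lie_manifold;
  gone : lie_manifold;
  gmulA : forall g h k, gmul g (gmul h k) = gmul (gmul g h) k;
  gmul1 : forall g, gmul gone g = g;
  gmulV : forall g, gmul (ginv g) g = gone;
  gmul_smooth : smooth2 gmul;
  ginv_smooth : smooth ginv
}.

Arguments gone {R l}.

Section Lie.
Context {R : realType} (G : lieGroup R).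

(* T_e G *)
Definition lieAlg : lmodType R := 'rV[R]_(mdim G).

Definition conjG (g h : G) : G := gmul (gmul g h) (ginv g).

Definition Ad (g : G) (x : lieAlg) : lieAlg := tangent_map (conjG g) gone x.

(* [x, y] = ad x y, where ad is the derivative at e of Ad : G -> GL(g). *)
Definition lie_bracket (x y : lieAlg) : lieAlg :=
  let c := chart_at (gone : G) in
  'D_x (fun z : 'rV[R]_(mdim G) => Ad (cparam c z) y : 'rV[R]_(mdim G))
       (ccoord c gone).

(* The property that characterises exp : t |-> exp (t x) is the one-parameter
   subgroup with initial velocity x. *)
Definition is_exponential (expG : lieAlg -> G) : Prop :=
  forall x : lieAlg, let gamma := fun t : R => expG (t *: x) in
    [/\ smooth_curve gamma,
        forall s t, gamma (s + t) = gmul (gamma s) (gamma t) &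
        velocity0 gamma = x].

Definition is_inner_product (ip : lieAlg -> lieAlg -> R^o) : Prop :=
  [/\ forall r x y z, ip (r *: x + y) z = r * ip x z + ip y z,
      forall x y, ip x y = ip y x &
      forall x, x != 0 -> 0 < (ip x x : R)].

Definition Ad_invariant (ip : lieAlg -> lieAlg -> R^o) : Prop :=
  forall g x y, ip (Ad g x) (Ad g y) = ip x y.

Definition thetaL (g : G) (v : 'rV[R]_(mdim G)) : lieAlg :=
  tangent_map (gmul (ginv g)) g v.

Definition thetaR (g : G) (v : 'rV[R]_(mdim G)) : lieAlg :=
  tangent_map (fun h : G => gmul h (ginv g)) g v.

(* (1/12) <thetaL, [thetaL, thetaL]> *)
Definition cartan_form (ip : lieAlg -> lieAlg -> R^o) : mform G :=
  (12%:R^-1 : R) *: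
    (wedge1 ip thetaL (wedge1 lie_bracket thetaL (form1 thetaL)) : mform G).

(* <thetaL + thetaR, x> *)
Definition theta_pairing (ip : lieAlg -> lieAlg -> R^o) (x : lieAlg) : mform G :=
  form1 (fun g v => ip (thetaL g v + thetaR g v) x).

Definition smooth_action (M : manifold R) (act : G -> M -> M) : Prop :=
  [/\ smooth2 act, forall p, act gone p = p &
      forall g h p, act (gmul g h) p = act g (act h p)].

Definition fundamental_field (expG : lieAlg -> G) (M : manifold R)
    (act : G -> M -> M) (x : lieAlg) (p : M) : 'rV[R]_(mdim M) :=
  velocity0 (fun t : R => act (expG (- (t *: x))) p).

End Lie.

Section Cartan.
Context {R : realType} (G : lieGroup R).

(* Functions g -> Omega(P); those in the Cartan model are cut out by
   [cartan_cochain]. *)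
Definition cochain (P : manifold R) : lmodType R := lieAlg G -> mform P.

(* S^p g^* (x) Omega^q(P): finite sums of products of p linear functionals
   with coefficients in Omega^q(P). *)
Definition poly_form (P : manifold R) (p q : nat) (a : cochain P) : Prop :=
  exists (N : nat) (l : 'I_N -> 'I_p -> {linear lieAlg G -> R^o})
         (w : 'I_N -> mform P),
    (forall j, is_form q (w j)) /\
    forall x, a x = \sum_j ((\prod_i l j i x : R) *: w j).

(* Equivariance a (Ad g x) = (g^-1)^* (a x), after applying g^*. *)
Definition equivariant_cochain (P : manifold R) (act : G -> P -> P)
    (a : cochain P) : Prop :=
  forall g x, pullback (act g) (a (Ad g x)) = a x.

(* C_G^k(P), the direct sum over 2p + q = k of (S^p g^* (x) Omega^q(P))^G *)
Definition cartan_cochain (P : manifold R) (act : G -> P -> P) (k : nat)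
    (a : cochain P) : Prop :=
  exists b : nat -> cochain P,
    (forall p, (p.*2 <= k)%N ->
       poly_form p (k - p.*2) (b p) /\ equivariant_cochain act (b p)) /\
    a = \sum_(p < k./2.+1) b p.

Definition extdG (expG : lieAlg G -> G) (P : manifold R) (act : G -> P -> P)
    (a : cochain P) : cochain P :=
  fun x => extd (a x) - iprod (fundamental_field expG act x) (a x).

Section Relative.
Context (expG : lieAlg G -> G) (M : manifold R) (act : G -> M -> M)
  (mu : M -> G).

Definition rel_form (k : nat) (w : mform G * mform M) : Prop :=
  is_form k w.1 /\ (if k is k'.+1 then is_form k' w.2 else w.2 = 0).

Definition rel_cochain (k : nat) (a : cochain G * cochain M) : Prop :=
  cartan_cochain (@conjG R G) k a.1 /\
  (if k is k'.+1 then cartan_cochain act k' a.2 else a.2 = 0).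

Definition rel_extdG (a : cochain G * cochain M) : cochain G * cochain M :=
  (extdG expG (@conjG R G) a.1,
   (fun x => pullback mu (a.1 x)) - extdG expG act a.2).

(* (g^* (x) Omega^1(mu))^G, with Omega^1(mu) = Omega^1(G) (+) Omega^0(M) *)
Definition rel_linear1 (m : cochain G * cochain M) : Prop :=
  [/\ poly_form 1 1 m.1, equivariant_cochain (@conjG R G) m.1,
      poly_form 1 0 m.2 & equivariant_cochain act m.2].

Definition const_cochain (w : mform G * mform M) : cochain G * cochain M :=
  (fun=> w.1, fun=> w.2).

Definition one_step_extension (w : mform G * mform M)
    (wG : cochain G * cochain M) : Prop :=
  [/\ rel_form 3 w,
      exists m, rel_linear1 m /\ wG = const_cochain w - m,
      rel_cochain 3 wG & rel_extdG wG = 0].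

(* M(x) = (1/2 <thetaL + thetaR, x>, 0) *)
Definition moment (ip : lieAlg G -> lieAlg G -> R^o) :
    cochain G * cochain M :=
  (fun x => (2%:R^-1 : R) *: theta_pairing ip x, 0).

End Relative.
End Cartan.

(* Main.v *)
(* The M-component of d_G^mu varpi_G splits by form degree: degree 3 is (QH1) and
   degree 1, for each x, is (QH2).  So everything rests on its G-component being
   0 identically, that is d eta = 0, iota_(v_x) eta = - 1/2 d<thetaL + thetaR, x>
   and <thetaL(v_x) + thetaR(v_x), x> = 0, and on eta and <thetaL + thetaR, x>
   being smooth equivariant forms.

   Write q(a, b) = d_a d_b (a.b) for the mixed second derivative of the product
   in a chart at e.  Then [x, y] = q(x, y) - q(y, x), by differentiating twice
   (g h g^-1) g = g h, and thetaL = D(g^-1 h) at h = g gives the Maurer-Cartan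
   equation d thetaL(u, v) = - [thetaL u, thetaL v].  With thetaR = Ad_g thetaL
   this yields d thetaR(u, v) = [thetaR u, thetaR v], and v_x at g satisfies
   thetaL(v_x) = x - Ad_(g^-1) x.  The second identity follows by Ad-invariance,
   and d eta = 0 is Maurer-Cartan plus the Jacobi identity. *)
Require Import Defs.
From HB Require Import structures.
From mathcomp Require Import all_boot all_order all_algebra.
From mathcomp Require Import all_classical all_reals all_analysis.
From mathcomp Require Import ring lra.
Import Order.TTheory GRing.Theory Num.Theory numFieldNormedType.Exports.
Set Implicit Arguments.
Unset Strict Implicit.
Unset Printing Implicit Defensive.
Local Open Scope classical_set_scope.
Local Open Scope ring_scope.

(** Tangent vectors at p are read in [chart_at p], a choice that need not vary continuously with p,
    so vector fields and forms cannot be differentiated as they stand. The proof therefore works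
    with plots, that is maps [a] from a normed space V into the manifold. The vector [mderiv a t s]
    is the velocity of [a] in the chart frozen at [a t], and the chain rule [tangent_map_mderiv]
    says how tangent maps act on velocities. On the group, [thetaL] and [thetaR] carry every
    velocity into the single space [lieAlg G], so [pullL a s] and [pullR a s] are ordinary smooth
    functions on V. With the chart parametrisation at g as the plot, d eta and d<thetaL + thetaR, x>
    become directional derivatives of expressions in these functions, and only Leibniz rules and
    symmetry of second derivatives remain. *)

Lemma linear_pack (K : pzRingType) (V W : lmodType K) (L : V -> W) : linear L ->
  exists L' : {linear V -> W}, L = L'.
Proof.
move=> linL; pose m := GRing.isLinear.Build _ _ _ _ _ linL.
by exists (HB.pack_for {linear V -> W} L m).
Qed.

Lemma zero_is_linear (K : pzRingType) (V W : lmodType K) : linear (fun _ : V => 0 : W).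
Proof. by move=> r x y; rewrite scaler0 addr0. Qed.

Section IsLinear.
Variables (K : pzRingType) (A B : lmodType K) (L : A -> B).
Hypothesis linL : linear L.

Lemma is_linearD x y : L (x + y) = L x + L y.
Proof. by have := linL 1 x y; rewrite !scale1r. Qed.

Lemma is_linear0 : L 0 = 0.
Proof. by apply: (addrI (L 0)); rewrite -is_linearD !addr0. Qed.

Lemma is_linearZ a x : L (a *: x) = a *: L x.
Proof. by have := linL a x 0; rewrite is_linear0 !addr0. Qed.

Lemma is_linearN x : L (- x) = - L x.
Proof. by rewrite -scaleN1r is_linearZ scaleN1r. Qed.

Lemma is_linearB x y : L (x - y) = L x - L y.
Proof. by rewrite is_linearD is_linearN. Qed.

End IsLinear.

(** * Smooth maps between normed spaces *)

Section Calculus.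
Context {R : realType}.
Implicit Types U V W : normedModType R.

Lemma near_eq_continuous (T S : topologicalType) (f g : T -> S) (x : T) :
  (\near x, f x = g x) -> {for x, continuous f} -> {for x, continuous g}.
Proof.
move=> fg fc; have E := nbhs_singleton fg; rewrite /prop_for /continuous_at -E.
by apply: cvg_trans fc; apply: near_eq_cvg; apply: filterS fg => y.
Qed.

(** [differentiable g x] speaks of the chosen differential ['d g x], of which nothing is known yet.
    The expansion of [g] is first proved with ['d f x], and uniqueness of the differential then
    identifies the two. *)
Lemma near_eq_differentiable V W (f g : V -> W) (x : V) :
  (\near x, f x = g x) -> differentiable f x -> differentiable g x.
Proof.
move=> fg df; have fgx := nbhs_singleton fg.
suff E : g \o shift x = cst (g x) + 'd f x +o_ 0 id.
  have -> : differentiable g x <-> (continuous ('d g x) /\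
     (g \o shift x = cst (g x) + 'd g x +o_ 0 id)) by exact: diff_locallyP.
  have dc := diff_continuous df.
  by rewrite (diff_unique dc E).
apply/eqaddoP => _/posnumP[e].
have /diff_locally/eqaddoP/(_ _ (gt0 e)) H := df.
have : \forall h \near (0 : V), f (h + x) = g (h + x).
  by have := fg; rewrite (near_shift 0) subr0.
move=> H1; apply: filterS2 H1 H => h E.
by rewrite -[X in _ -> is_true (`|X| <= _)]/(g (h + x) - (g x + 'd f x h)) -E -fgx.
Qed.

Lemma open_near (T : topologicalType) (U : set T) (x : T) (P : T -> Prop) :
  open U -> U x -> (forall y, U y -> P y) -> \near x, P x.
Proof. by move=> oU Ux UP; apply: filterS UP _; apply: open_nbhs_nbhs. Qed.

Lemma derive_linear_comp V W W' (L : W -> W') (f : V -> W) x v :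
  linear L -> continuous L -> differentiable f x ->
  'D_v (L \o f) x = L ('D_v f x).
Proof.
move=> /linear_pack [L' ->] cL df.
have dL : differentiable L' (f x) by apply: linear_differentiable.
rewrite deriveE; last exact: differentiable_comp.
by rewrite diff_comp //= diff_lin // deriveE.
Qed.

Lemma differentiable_linear V W (L : V -> W) x :
  linear L -> continuous L -> differentiable L x.
Proof. by move=> /linear_pack [L' ->] cL; apply: linear_differentiable. Qed.

Lemma scale_is_bilinear W :
  bilinear_for
    (GRing.Scale.Law.clone _ _ *:%R _) (GRing.Scale.Law.clone _ _ *:%R _)
    (fun (a : R^o) (w : W) => a *: w).
Proof.
split=> [u'|u] a x y /=.
- by rewrite scalerDl scalerA.
- by rewrite scalerDr !scalerA mulrC.
Qed.

Lemma derive_scale V W (a : V -> R^o) (g : V -> W) x :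
  differentiable a x -> differentiable g x ->
  differentiable (fun y => a y *: g y) x /\
  forall v, 'D_v (fun y => a y *: g y) x = a x *: 'D_v g x + 'D_v a x *: g x.
Proof.
move=> da dg.
pose m := bilinear_isBilinear.Build R R^o W W _ _ _ (scale_is_bilinear W).
pose b : {bilinear R^o -> W -> W} :=
  HB.pack_for {bilinear R^o -> W -> W} (fun (a : R^o) (w : W) => a *: w) m.
have cb : continuous (fun p : R^o * W => b p.1 p.2).
  by move=> p; apply: (@scale_continuous R W).
have db := differentiable_bilin (f := b) (a x, g x) cb.
have dp : differentiable (fun y => (a y, g y)) x by apply: differentiable_pair.
pose B := fun p : R^o * W => b p.1 p.2.
have dBE : 'd B (a x, g x) = (fun q => b (a x) q.2 + b q.1 (g x)) :> (_ -> _).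
  exact: diff_bilin.
have -> : (fun y => a y *: g y) = B \o (fun y => (a y, g y)) by [].
split; first exact: differentiable_comp.
move=> v; rewrite deriveE; last exact: differentiable_comp.
rewrite diff_comp // -[LHS]/('d B (a x, g x) ('d _ x v)) dBE diff_pair //=.
by rewrite !deriveE.
Qed.

Lemma Ck_on_eq V W k (U : set V) (f g : V -> W) :
  open U -> (forall x, U x -> f x = g x) -> Ck_on k U f -> Ck_on k U g.
Proof.
move=> oU; elim: k f g => [|k IH] f g fg /=.
  by move=> fc x Ux; apply: near_eq_continuous (fc x Ux); exact: open_near fg.
case=> df Df; split=> [x Ux|v].
  by apply: near_eq_differentiable (df x Ux); exact: open_near fg.
apply: IH (Df v) => x Ux; apply: near_eq_derive; exact: open_near fg.
Qed.

Lemma Ck_on_sub V W k (U U' : set V) (f : V -> W) :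
  U `<=` U' -> Ck_on k U' f -> Ck_on k U f.
Proof.
move=> UU'; elim: k f => [|k IH] f /=; first by move=> H x /UU' /H.
by case=> H H'; split=> [x /UU' /H //|v]; apply: IH.
Qed.

Lemma Ck_on0 V W k (U : set V) (f : V -> W) : Ck_on k U f -> Ck_on 0 U f.
Proof.
by case: k => //= k [df _] x Ux; apply: differentiable_continuous; apply: df.
Qed.

Lemma Ck_onS V W k (U : set V) (f : V -> W) : Ck_on k.+1 U f -> Ck_on k U f.
Proof.
elim: k f => [|k IH] f; first exact: Ck_on0.
by case=> df Df; split=> // v; apply: IH; apply: Df.
Qed.

Lemma Ck_on_cst V W k (U : set V) (w : W) : Ck_on k U (cst w : V -> W).
Proof.
elim: k w => [|k IH] w /=; first by move=> x _; apply: cst_continuous.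
split=> [x _|v]; first exact: differentiable_cst.
have -> : (fun x : V => 'D_v (cst w) x) = cst (0 : W); last exact: IH.
by apply/funext => x; rewrite derive_cst.
Qed.

Lemma Ck_onD V W k (U : set V) (f g : V -> W) :
  open U -> Ck_on k U f -> Ck_on k U g -> Ck_on k U (fun x => f x + g x).
Proof.
move=> oU; elim: k f g => [|k IH] f g /=.
  by move=> fc gc x Ux; apply: continuousD; [exact: fc|exact: gc].
move=> [df Df] [dg Dg]; split=> [x Ux|v].
  by apply: differentiableD; [exact: df|exact: dg].
apply: Ck_on_eq (IH _ _ (Df v) (Dg v)) => // x Ux.
by rewrite -deriveD //; apply: diff_derivable; [exact: df|exact: dg].
Qed.

Lemma Ck_on_sum V W k (U : set V) n (f : 'I_n -> V -> W) :
  open U -> (forall i, Ck_on k U (f i)) -> Ck_on k U (fun x => \sum_i f i x).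
Proof.
move=> oU; elim: n f => [|n IH] f fC.
  have -> : (fun x => \sum_(i < 0) f i x) = cst 0; last exact: Ck_on_cst.
  by apply/funext => x; rewrite big_ord0.
have -> : (fun x => \sum_(i < n.+1) f i x) =
  (fun x => f ord0 x + \sum_(i < n) f (lift ord0 i) x).
  by apply/funext => x; rewrite big_ord_recl.
by apply: Ck_onD => //; apply: IH => i; apply: fC.
Qed.

Lemma Ck_on_linear V W W' k (U : set V) (L : W -> W') (f : V -> W) :
  open U -> linear L -> continuous L -> Ck_on k U f -> Ck_on k U (L \o f).
Proof.
move=> oU linL cL; elim: k f => [|k IH] f /=.
  by move=> fc x Ux; apply: continuous_comp; [exact: fc|exact: cL].
case=> df Df; split=> [x Ux|v].
  by apply: differentiable_comp; [exact: df|exact: differentiable_linear].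
apply: Ck_on_eq (IH _ (Df v)) => // x Ux.
by rewrite derive_linear_comp //; exact: df.
Qed.

Lemma Ck_on_scale V W k (U : set V) (a : V -> R^o) (g : V -> W) :
  open U -> Ck_on k U a -> Ck_on k U g -> Ck_on k U (fun x => a x *: g x).
Proof.
move=> oU; elim: k a g => [|k IH] a g.
  by move=> ca cg x Ux; apply: continuousZ; [exact: ca|exact: cg].
move=> Ca Cg; have [[da Da] [dg Dg]] := (Ca, Cg); split=> [x Ux|v].
  by have [] := derive_scale (da x Ux) (dg x Ux).
have := Ck_onD oU (IH _ _ (Ck_onS Ca) (Dg v)) (IH _ _ (Da v) (Ck_onS Cg)).
apply: Ck_on_eq => // x Ux.
by have [_ ->] := derive_scale (da x Ux) (dg x Ux).
Qed.

(* The hypothesis under which the chain rule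
   D_v (f o g) = \sum_i l_i (D_v g) D_(e_i) f
   makes C^k maps, defined here by directional derivatives, stable by
   composition. *)
Definition fin_dim V := exists n (e : 'I_n -> V) (l : 'I_n -> V -> R^o),
  [/\ forall i, linear (l i), forall i, continuous (l i) &
      forall x, x = \sum_i l i x *: e i].

Lemma derive_sumZ V W n (f : V -> W) x (a : 'I_n -> R) (e : 'I_n -> V) :
  differentiable f x -> 'D_(\sum_i a i *: e i) f x = \sum_i a i *: 'D_(e i) f x.
Proof.
by move=> df; rewrite deriveE // linear_sum; apply: eq_bigr => i _;
  rewrite linearZ deriveE.
Qed.

Lemma derive_comp V W W' (f : W -> W') (g : V -> W) x v :
  differentiable g x -> differentiable f (g x) ->
  'D_v (f \o g) x = 'D_('D_v g x) f (g x).
Proof.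
move=> dg df; rewrite deriveE; last exact: differentiable_comp.
by rewrite diff_comp //= deriveE // deriveE.
Qed.

Lemma Ck_on_comp V W W' k (U : set V) (U' : set W) (f : W -> W') (g : V -> W) :
  fin_dim W -> open U -> (forall x, U x -> U' (g x)) ->
  Ck_on k U g -> Ck_on k U' f -> Ck_on k U (f \o g).
Proof.
move=> [n [e [l [linl cl El]]]] oU gU; elim: k f => [|k IH] f.
  by move=> gc fc x Ux; apply: continuous_comp; [exact: gc|exact/fc/gU].
move=> Cg [df Df]; have [dg Dg] := Cg; split=> [x Ux|v].
  by apply: differentiable_comp; [exact: dg|exact/df/gU].
have H : Ck_on k U (fun x => \sum_i l i ('D_v g x) *: 'D_(e i) f (g x)).
  apply: Ck_on_sum => // i; apply: Ck_on_scale => //.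
    exact: (Ck_on_linear oU (linl i) (cl i) (Dg v)).
  by apply: (IH (fun y => 'D_(e i) f y)); [exact: Ck_onS|exact: Df].
apply: Ck_on_eq H => // x Ux.
have df' := df _ (gU _ Ux).
by rewrite derive_comp //; [rewrite [in RHS](El ('D_v g x)) derive_sumZ|exact: dg].
Qed.

End Calculus.

(** * Germs of smooth maps, finite-dimensional domains and bilinear maps *)

Section SmoothAt.
Context {R : realType}.
Implicit Types U V W : normedModType R.

Lemma coord_linear n (i : 'I_n) : linear (fun x : 'rV[R]_n => x 0 i : R^o).
Proof. by move=> a x y; rewrite !mxE. Qed.

Lemma coord_continuousV n (i : 'I_n) : continuous (fun x : 'rV[R]_n => x 0 i : R^o).
Proof. exact: coord_continuous. Qed.

Lemma rV_linear_continuous n W (L : 'rV[R]_n -> W) : linear L -> continuous L.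
Proof.
move=> /linear_pack [L' ->].
have -> : (L' : _ -> _) = fun x => \sum_j x 0 j *: L' (delta_mx 0 j).
  apply/funext => x; rewrite [in LHS](row_sum_delta x) linear_sum.
  by apply: eq_bigr => j _; rewrite linearZ.
have H := Ck_on_sum (k := 0%N) openT (fun j => Ck_on_scale (k := 0%N) openT
  (fun x _ => @coord_continuousV n j x) (Ck_on_cst 0 setT (L' (delta_mx 0 j)))).
by move=> x; apply: H.
Qed.

Lemma fin_dim_rV n : fin_dim ('rV[R]_n : normedModType R).
Proof.
exists n, (fun i => delta_mx 0 i), (fun i (x : 'rV[R]_n) => x 0 i : R^o); split=> [i|i|x].
- exact: coord_linear.
- exact: coord_continuousV.
- exact: row_sum_delta.
Qed.

Lemma inl_linear V W : linear (fun w : V => (w, 0) : (V * W)%type).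
Proof. by move=> a u v; congr (_, _) => /=; rewrite scaler0 addr0. Qed.

Lemma inr_linear V W : linear (fun w : W => (0, w) : (V * W)%type).
Proof. by move=> a u v; congr (_, _) => /=; rewrite scaler0 addr0. Qed.

Lemma fin_dim_prod V W : fin_dim V -> fin_dim W -> fin_dim (V * W)%type.
Proof.
move=> [n [e [l [ll lc lE]]]] [m [e' [l' [ll' lc' lE']]]].
exists (n + m)%N,
  (fun i => match fintype.split i with inl j => (e j, 0) | inr j => (0, e' j) end),
  (fun i x => match fintype.split i with inl j => l j x.1 | inr j => l' j x.2 end).
split=> [i|i|[x y]].
- by case: (fintype.split i) => j a u v; [apply: ll|apply: ll'].
- case: (fintype.split i) => j u.
    by apply: (@continuous_comp _ _ _ fst (l j)); [exact: cvg_fst|exact: lc].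
  by apply: (@continuous_comp _ _ _ snd (l' j)); [exact: cvg_snd|exact: lc'].
rewrite big_split_ord /=.
under eq_bigr do rewrite -[lshift _ _]/(unsplit (inl _)) unsplitK.
under [X in _ = _ + X]eq_bigr do rewrite -[rshift _ _]/(unsplit (inr _)) unsplitK.
have [L EL] := linear_pack (@inl_linear V W).
have E w : (w, 0) = L w by rewrite -EL.
have [L' EL'] := linear_pack (@inr_linear V W).
have E' w : (0, w) = L' w by rewrite -EL'.
have -> : \sum_i l i x *: (e i, 0 : W) = (x, 0).
  by rewrite E [in RHS](lE x) linear_sum; apply: eq_bigr => i _; rewrite E linearZ.
have -> : \sum_i l' i y *: (0 : V, e' i) = (0, y).
  by rewrite E' [in RHS](lE' y) linear_sum; apply: eq_bigr => i _; rewrite E' linearZ.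
by congr (_, _); rewrite /= ?addr0 ?add0r.
Qed.

(** One neighbourhood serves all orders of differentiation, so the property spreads to nearby points
    ([smooth_at_near]). *)
Definition smooth_at V W (x : V) (f : V -> W) :=
  exists U : set V, [/\ open U, U x & smooth_on U f].

Lemma smooth_on_at V W (U : set V) (f : V -> W) x :
  nbhs x U -> smooth_on U f -> smooth_at x f.
Proof.
rewrite nbhsE => -[U' [oU' U'x] sU] sf; exists U'; split=> // k.
exact: Ck_on_sub sU (sf k).
Qed.

Lemma smooth_at_near V W (x : V) (f : V -> W) :
  smooth_at x f -> \near x, smooth_at x f.
Proof. by move=> [U [oU Ux sf]]; apply: (open_near oU Ux) => y Uy; exists U. Qed.

Lemma smooth_at_on V W (U : set V) (f : V -> W) :
  (forall x, U x -> smooth_at x f) -> smooth_on U f.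
Proof.
move=> fU k; elim: k f fU => [|k IH] f fU.
  by move=> x Ux; have [U' [_ U'x /(_ 0%N)]] := fU x Ux; apply.
split=> [x Ux|v]; first by have [U' [_ U'x /(_ 1%N) []]] := fU x Ux; move=> + _; apply.
apply: IH => x Ux; have [U' [oU' U'x sf]] := fU x Ux; exists U'; split=> // k'.
by have [_] := sf k'.+1; apply.
Qed.

Lemma smooth_at_eq V W (x : V) (f g : V -> W) :
  (\near x, f x = g x) -> smooth_at x f -> smooth_at x g.
Proof.
move=> fg [U [oU Ux sf]].
have [U' [oU' U'x] U'fg] : exists2 U', open_nbhs x U' & U' `<=` (fun x => f x = g x).
  by move: fg; rewrite /prop_near1 nbhsE.
exists (U `&` U'); split=> [||k]; first exact: openI.
  by [].
apply: Ck_on_eq (Ck_on_sub _ (sf k)); first exact: openI.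
  by move=> y [_ /U'fg].
by move=> y [].
Qed.

Lemma smooth_at_differentiable V W (x : V) (f : V -> W) :
  smooth_at x f -> differentiable f x.
Proof. by move=> [U [_ Ux /(_ 1%N) [df _]]]; exact: df. Qed.

Lemma smooth_at_derivable V W (x v : V) (f : V -> W) :
  smooth_at x f -> derivable f x v.
Proof. by move=> /smooth_at_differentiable df; apply: diff_derivable. Qed.

Lemma smooth_at_continuous V W (x : V) (f : V -> W) :
  smooth_at x f -> {for x, continuous f}.
Proof. by move=> [U [_ Ux /(_ 0%N)]]; exact. Qed.

Lemma smooth_at_derive V W (x v : V) (f : V -> W) :
  smooth_at x f -> smooth_at x (fun y => 'D_v f y).
Proof. by move=> [U [oU Ux sf]]; exists U; split=> // k; have [_] := sf k.+1; apply. Qed.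

Lemma smooth_at_cst V W (x : V) (w : W) : smooth_at x (fun=> w).
Proof. by exists setT; split=> // [|k]; [exact: openT|exact: Ck_on_cst]. Qed.

Lemma smooth_atD V W (x : V) (f g : V -> W) :
  smooth_at x f -> smooth_at x g -> smooth_at x (fun y => f y + g y).
Proof.
move=> [U [oU Ux sf]] [U' [oU' U'x sg]].
have oI := openI oU oU'; exists (U `&` U'); split=> // k.
by apply: Ck_onD => //; [apply: Ck_on_sub (sf k)|apply: Ck_on_sub (sg k)] => y [].
Qed.

Lemma smooth_at_sum V W (x : V) n (f : 'I_n -> V -> W) :
  (forall i, smooth_at x (f i)) -> smooth_at x (fun y => \sum_i f i y).
Proof.
elim: n f => [|n IH] f fC.
  apply: smooth_at_eq (smooth_at_cst x 0); near=> y; by rewrite big_ord0.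
apply: smooth_at_eq (smooth_atD (fC ord0) (IH _ (fun i => fC (lift ord0 i)))).
by near=> y; rewrite big_ord_recl.
Unshelve. all: by end_near. Qed.

Lemma smooth_at_scale V W (x : V) (a : V -> R^o) (g : V -> W) :
  smooth_at x a -> smooth_at x g -> smooth_at x (fun y => a y *: g y).
Proof.
move=> [U [oU Ux sf]] [U' [oU' U'x sg]].
have oI := openI oU oU'; exists (U `&` U'); split=> // k.
by apply: Ck_on_scale => //; [apply: Ck_on_sub (sf k)|apply: Ck_on_sub (sg k)] => y [].
Qed.

Lemma smooth_at_linear V W W' (x : V) (L : W -> W') (f : V -> W) :
  linear L -> continuous L -> smooth_at x f -> smooth_at x (fun y => L (f y)).
Proof.
move=> linL cL [U [oU Ux sf]]; exists U; split=> // k.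
by apply: (Ck_on_linear oU linL cL).
Qed.

Lemma smooth_at_id V (x : V) : smooth_at x id.
Proof.
exists setT; split=> // [|k]; first exact: openT.
case: k => [|k] /=; first by move=> y _; apply: cvg_id.
split=> [y _|v]; first exact: (@ex_diff _ _ _ _ _ _ id).
have -> : (fun x : V => 'D_v id x) = cst v; last exact: Ck_on_cst.
by apply/funext => y; rewrite derive_id.
Qed.

Lemma smooth_at_comp V W W' (x : V) (f : W -> W') (g : V -> W) :
  fin_dim W -> smooth_at x g -> smooth_at (g x) f -> smooth_at x (fun y => f (g y)).
Proof.
move=> fW sg; have gc := smooth_at_continuous sg.
move: sg => [U [oU Ux sg]] [U' [oU' U'gx sf]].
have : nbhs x (g @^-1` U') by apply: gc; apply: open_nbhs_nbhs.
rewrite nbhsE => -[U'' [oU'' U''x] sU'']; have oI := openI oU oU''.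
exists (U `&` U''); split=> // k.
apply: (Ck_on_comp fW oI (U' := U')); last exact: sf.
  by move=> y [_ /sU''].
by apply: Ck_on_sub (sg k) => y [].
Qed.

Lemma smooth_at_pair V W W' (x : V) (f : V -> W) (g : V -> W') :
  smooth_at x f -> smooth_at x g -> smooth_at x (fun y => (f y, g y)).
Proof.
move=> sf sg.
have c1 : continuous (fun w : W => (w, 0) : (W * W')%type).
  by move=> w; apply: cvg_pair; [exact: cvg_id|exact: cvg_cst].
have c2 : continuous (fun w : W' => (0, w) : (W * W')%type).
  by move=> w; apply: cvg_pair; [exact: cvg_cst|exact: cvg_id].
have := smooth_atD (smooth_at_linear (@inl_linear _ _) c1 sf)
  (smooth_at_linear (@inr_linear _ _) c2 sg).
apply: smooth_at_eq; near=> y.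
by congr (_, _) => /=; rewrite ?addr0 ?add0r.
Unshelve. all: by end_near. Qed.

Lemma smooth_at_coord V n (x : V) (f : V -> 'rV[R]_n) i :
  smooth_at x f -> smooth_at x (fun y => f y 0 i : R^o).
Proof. exact: (smooth_at_linear (coord_linear i) (@coord_continuousV n i)). Qed.

Lemma bilinear_sum n W' W (B : 'rV[R]_n -> W' -> W) (a : 'rV[R]_n) (b : W') :
  linear (B^~ b) -> B a b = \sum_i a 0 i *: B (delta_mx 0 i) b.
Proof.
move=> /linear_pack [L EL]; have E z : B z b = L z by rewrite -EL.
rewrite E [in LHS](row_sum_delta a) linear_sum.
by apply: eq_bigr => i _; rewrite linearZ E.
Qed.

(** Expanding only the first argument in coordinates leaves scalar multiples of the maps
    [B (delta_mx 0 i)], which are continuous because they are linear on row vectors. *)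
Lemma smooth_at_bilinear V n m W (B : 'rV[R]_n -> 'rV[R]_m -> W) (x : V) f g :
  (forall b, linear (B^~ b)) -> (forall a, linear (B a)) ->
  smooth_at x f -> smooth_at x g -> smooth_at x (fun y => B (f y) (g y)).
Proof.
move=> Bl Br sf sg.
have : smooth_at x (fun y => \sum_i (f y 0 i : R^o) *: B (delta_mx 0 i) (g y)).
  apply: smooth_at_sum => i; apply: smooth_at_scale; first exact: smooth_at_coord.
  by apply: (smooth_at_linear (Br _)) => //; apply: rV_linear_continuous.
by apply: smooth_at_eq; near=> y; rewrite -bilinear_sum.
Unshelve. all: by end_near. Qed.

Lemma derive_bilinear V n m W (B : 'rV[R]_n -> 'rV[R]_m -> W) (x v : V) f g :
  (forall b, linear (B^~ b)) -> (forall a, linear (B a)) ->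
  differentiable f x -> differentiable g x ->
  'D_v (fun y => B (f y) (g y)) x = B ('D_v f x) (g x) + B (f x) ('D_v g x).
Proof.
move=> Bl Br df dg.
have cB a : continuous (B a) by apply: rV_linear_continuous.
have dBg a : differentiable (fun y => B a (g y)) x.
  by apply: differentiable_comp => //; apply: differentiable_linear.
have dfi i : differentiable (fun y => f y 0 i : R^o) x.
  exact: (differentiable_comp df (differentiable_linear (f x) (coord_linear i)
    (@coord_continuousV n i))).
have -> : (fun y => B (f y) (g y)) =
   \sum_i (fun y => (f y 0 i : R^o) *: B (delta_mx 0 i) (g y)).
  by apply/funext => y; rewrite fct_sumE bilinear_sum.
rewrite derive_sum; last first.
  move=> i; apply: diff_derivable.
  by have [] := derive_scale (dfi i) (dBg (delta_mx 0 i)).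
rewrite [X in _ = X + _]bilinear_sum // [X in _ = _ + X]bilinear_sum //.
rewrite -big_split; apply: eq_bigr => i _ /=.
have [_ ->] := derive_scale (dfi i) (dBg (delta_mx 0 i)).
rewrite addrC; congr (_ *: _ + _ *: _).
  exact: (derive_linear_comp v (Br _) (cB _) dg).
exact: (derive_linear_comp v (coord_linear i) (@coord_continuousV n i) df).
Qed.

(** The two difference quotients are the same function of h, so a partial derivative is a
    directional derivative of the map on pairs. *)
Lemma derive_pairl V W W' (F : V * W -> W') a b v :
  'D_v (fun y => F (y, b)) a = 'D_(v, 0) F (a, b).
Proof.
have E : (fun h : R => h^-1 *: (((fun y => F (y, b)) \o shift a) (h *: v) - F (a, b)))
  = (fun h => h^-1 *: ((F \o shift (a, b)) (h *: (v, 0)) - F (a, b))).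
  apply/funext => h /=; congr (_ *: (F _ - _)).
  by congr (_, _); rewrite /= scaler0 add0r.
by rewrite /derive E.
Qed.

Lemma derive_pairr V W W' (F : V * W -> W') a b v :
  'D_v (fun y => F (a, y)) b = 'D_(0, v) F (a, b).
Proof.
have E : (fun h : R => h^-1 *: (((fun y => F (a, y)) \o shift b) (h *: v) - F (a, b)))
  = (fun h => h^-1 *: ((F \o shift (a, b)) (h *: (0, v)) - F (a, b))).
  apply/funext => h /=; congr (_ *: (F _ - _)).
  by congr (_, _); rewrite /= scaler0 add0r.
by rewrite /derive E.
Qed.

Lemma derive_pair V W W' (f : V -> W) (g : V -> W') (x v : V) :
  differentiable f x -> differentiable g x ->
  'D_v (fun y => (f y, g y)) x = ('D_v f x, 'D_v g x).
Proof.
move=> df dg; rewrite deriveE; last exact: differentiable_pair.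
by rewrite diff_pair //= !deriveE.
Qed.

Lemma derive_vecD V W (f : V -> W) (x u v : V) :
  differentiable f x -> 'D_(u + v) f x = 'D_u f x + 'D_v f x.
Proof. by move=> df; rewrite !deriveE // linearD. Qed.

Lemma derive_vec_linear V W (f : V -> W) (x : V) :
  differentiable f x -> linear (fun v => 'D_v f x).
Proof. by move=> df a u v; rewrite !deriveE // linearP. Qed.

End SmoothAt.

(** * Symmetry of second derivatives *)

Section Schwarz.
Context {R : realType}.
Implicit Types U V W : normedModType R.

Lemma is_derive_line V (f : V -> R^o) (a u : V) (s : R) :
  differentiable f (a + s *: u) ->
  is_derive s (1 : R) (fun s : R => f (a + s *: u) : R) ('D_u f (a + s *: u)).
Proof.
move=> df.
have E : (fun h : R => h^-1 *: (((fun s : R => f (a + s *: u)) \o shift s) (h *: 1) -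
     f (a + s *: u))) =
  (fun h : R => h^-1 *: ((f \o shift (a + s *: u)) (h *: u) - f (a + s *: u))).
  apply/funext => h /=; congr (_ *: (f _ - _)).
  by rewrite scalerDl -scalerA scale1r addrCA.
have dd : derivable f (a + s *: u) u by apply: diff_derivable.
split; first by rewrite /derivable /= E.
by rewrite /derive /= E.
Qed.

(* Mean value theorem twice; the left-hand side is symmetric in u and v, which
   gives the symmetry of second derivatives. *)
Lemma second_difference V (f : V -> R^o) (U : set V) (x u v : V) (h : R) :
  open U -> Ck_on 2 U f -> 0 < h ->
  (forall s t, 0 <= s <= h -> 0 <= t <= h -> U (x + s *: u + t *: v)) ->
  exists s t, [/\ 0 <= s <= h, 0 <= t <= h &
    f (x + h *: u + h *: v) - f (x + h *: u) - f (x + h *: v) + f x =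
    'D_v (fun y => 'D_u f y) (x + s *: u + t *: v) * h * h].
Proof.
move=> oU [df Df] h0 xU.
have hI s : s \in `]0, h[ -> 0 <= s <= h.
  by rewrite in_itv /= => /andP[/ltW-> /ltW->].
have hh : 0 <= h <= h by rewrite (ltW h0) lexx.
have h00 : 0 <= (0 : R) <= h by rewrite (ltW h0) lexx.
pose phi := fun s : R => (f (x + h *: v + s *: u) - f (x + s *: u) : R).
pose dphi := fun s : R =>
  ('D_u f (x + h *: v + s *: u) - 'D_u f (x + s *: u) : R).
have xU' s : 0 <= s <= h -> U (x + s *: u).
  by move=> hs; have := xU s 0 hs h00; rewrite scale0r addr0.
have xU'' s : 0 <= s <= h -> U (x + h *: v + s *: u).
  by move=> hs; have := xU s h hs hh; rewrite addrAC.
have dphiE s : 0 <= s <= h -> is_derive s (1 : R) phi (dphi s).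
  move=> hs.
  have d1 := is_derive_line (df _ (xU'' s hs)).
  have d2 := is_derive_line (df _ (xU' s hs)).
  exact: (is_deriveB d1 d2).
have [] := @MVT R phi dphi 0 h h0.
- by move=> s /hI; apply: dphiE.
- apply: derivable_within_continuous => s; rewrite in_itv /= => hs.
  by have [] := dphiE s hs.
move=> s /hI hs Es.
pose psi := fun t : R => 'D_u f (x + s *: u + t *: v) : R.
pose dpsi := fun t : R => 'D_v (fun y => 'D_u f y) (x + s *: u + t *: v) : R.
have [dDf _] := Df u.
have dpsiE t : 0 <= t <= h -> is_derive t (1 : R) psi (dpsi t).
  by move=> ht; apply: (is_derive_line (f := fun y => 'D_u f y)); apply: dDf; apply: xU.
have [] := @MVT R psi dpsi 0 h h0.
- by move=> t /hI; apply: dpsiE.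
- apply: derivable_within_continuous => t; rewrite in_itv /= => ht.
  by have [] := dpsiE t ht.
move=> t /hI ht Et.
exists s, t; split=> //.
move: Es Et; rewrite /phi /dphi /psi /dpsi !scale0r !addr0 subr0 => Es Et.
rewrite -Et [in X in X * h]addrAC -Es [x + h *: u + _]addrAC.
by ring.
Qed.

Lemma near_close V (F F' : V -> R^o) (U : set V) x (e : R) :
  open U -> U x -> {for x, continuous F} -> {for x, continuous F'} -> 0 < e ->
  exists2 d, 0 < d & forall y, `|x - y| < d ->
    [/\ U y, `|F x - F y| < e & `|F' x - F' y| < e].
Proof.
move=> oU Ux cF cF' e0.
move/cvgrPdist_lt: cF => /(_ _ e0) H1.
move/cvgrPdist_lt: cF' => /(_ _ e0) H2.
have H0 : nbhs x U by apply: open_nbhs_nbhs.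
have : \forall y \near x, [/\ U y, `|F x - F y| < e & `|F' x - F' y| < e].
  by apply: filterS3 H0 H1 H2 => y; split.
by move=> /nbhs_normP[d /= d0 Hd]; exists d.
Qed.

Lemma dist_half (a b c e : R) : `|a - c| < e / 2 -> `|b - c| < e / 2 -> `|a - b| <= e.
Proof.
rewrite !ltr_norml ler_norml => /andP[B1 B2] /andP[B3 B4].
by apply/andP; split; lra.
Qed.

(** Both mixed derivatives, taken at suitable points near x, equal the same second difference
    divided by h^2; by continuity their values at x are within any e of each other. *)
Lemma derive_swap_real V (f : V -> R^o) (x u v : V) :
  smooth_at x f -> 'D_u (fun y => 'D_v f y) x = 'D_v (fun y => 'D_u f y) x.
Proof.
move=> [U [oU Ux sf]].
have cont a b : {for x, continuous (fun y => 'D_a (fun y => 'D_b f y) y)}.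
  have [_ /(_ b) [_ /(_ a)]] := sf 2%N.
  exact.
apply/eqP; rewrite -subr_eq0 -normr_le0; apply/ler_addgt0Pr => e e0; rewrite add0r.
have e2 : 0 < e / 2 by rewrite divr_gt0.
have [d d0 Hd] := near_close oU Ux (cont u v) (cont v u) e2.
have n0 : 0 < `|u| + `|v| + 1 by apply: ltr_wpDl => //; apply: addr_ge0.
(* With this h the parallelogram spanned by h u and h v at x stays in the ball of radius d; the
   summand 1 keeps the denominator positive when u = v = 0. *)
pose h := d / (`|u| + `|v| + 1).
have h0 : 0 < h by rewrite divr_gt0.
have small s t : 0 <= s <= h -> 0 <= t <= h -> `|x - (x + s *: u + t *: v)| < d.
  move=> /andP[s0 sh] /andP[t0 th].
  rewrite -addrA opprD addNKr normrN (le_lt_trans (ler_normD _ _)) // !normrZ.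
  rewrite !ger0_norm // (@le_lt_trans _ _ (h * (`|u| + `|v|))) //.
    by rewrite mulrDr lerD // ler_wpM2r.
  by rewrite /h mulrAC ltr_pdivrMr // ltr_pM2l // ltrDl ltr01.
have [s [t [hs ht E1]]] : exists s t, [/\ 0 <= s <= h, 0 <= t <= h &
    f (x + h *: u + h *: v) - f (x + h *: u) - f (x + h *: v) + f x =
    'D_v (fun y => 'D_u f y) (x + s *: u + t *: v) * h * h].
  by apply: second_difference oU (sf 2%N) h0 _ => s t hs ht;
    have [] := Hd _ (small s t hs ht).
have [s' [t' [hs' ht' E2]]] : exists s t, [/\ 0 <= s <= h, 0 <= t <= h &
    f (x + h *: v + h *: u) - f (x + h *: v) - f (x + h *: u) + f x =
    'D_u (fun y => 'D_v f y) (x + s *: v + t *: u) * h * h].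
  by apply: second_difference oU (sf 2%N) h0 _ => s' t' hs' ht';
    rewrite addrAC; have [] := Hd _ (small t' s' ht' hs').
have E : 'D_v (fun y => 'D_u f y) (x + s *: u + t *: v) =
         'D_u (fun y => 'D_v f y) (x + s' *: v + t' *: u).
  apply: (mulIf (lt0r_neq0 h0)); apply: (mulIf (lt0r_neq0 h0)).
  apply: etrans (esym E1) (etrans _ E2).
  rewrite [x + h *: v + h *: u]addrAC; congr (_ + f x); exact: addrAC.
have [_ _ B1] := Hd _ (small s t hs ht).
have [_ B2 _] := Hd _ (small t' s' ht' hs').
rewrite addrAC -E in B2.
exact: dist_half B2 B1.
Qed.

Lemma derive_swap V n (f : V -> 'rV[R]_n) (x u v : V) :
  smooth_at x f -> 'D_u (fun y => 'D_v f y) x = 'D_v (fun y => 'D_u f y) x.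
Proof.
move=> sf; apply/rowP => i.
have L W' (h : W' -> 'rV[R]_n) y w := derive_linear_comp (f := h) (x := y) w
  (coord_linear i) (@coord_continuousV R n i).
have E a b : ('D_a (fun y => 'D_b f y) x) 0 i =
             'D_a (fun y => 'D_b (fun z => f z 0 i : R^o) y) x.
  rewrite -L; last exact/smooth_at_differentiable/smooth_at_derive.
  apply: near_eq_derive; have := smooth_at_near sf.
  by apply: filterS => y /smooth_at_differentiable dy; rewrite [RHS]L.
exact: (etrans (E u v) (etrans (derive_swap_real u v (smooth_at_coord i sf))
  (esym (E v u)))).
Qed.

End Schwarz.

(** * Smooth maps from normed spaces to manifolds *)

Section Plots.
Context {R : realType}.
Implicit Types (U V W : normedModType R) (P Q N : manifold R).

(** Continuity is a separate clause: it keeps [a y] in the domain of the chart for y near x, the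
    only region where the coordinate expression has a meaning. *)
Definition msmooth_at V P (x : V) (a : V -> P) :=
  {for x, continuous a} /\
  forall c, atlas c -> cdom c (a x) -> smooth_at x (fun y => ccoord c (a y)).

(** The chart stays frozen at [a x] while y moves, so the result is a vector of T_(a x) P in the
    identification made by [chart_at]. *)
Definition mderiv V P (a : V -> P) (x v : V) : 'rV[R]_(mdim P) :=
  'D_v (fun y => ccoord (chart_at (a x)) (a y)) x.

Lemma nbhs_cdom (T : topologicalType) n (c : chart R T n) p :
  cdom c p -> nbhs p (cdom c).
Proof. by move=> cp; apply: open_nbhs_nbhs; split=> //; apply: cdom_open. Qed.

Lemma nbhs_cimage (T : topologicalType) n (c : chart R T n) y :
  (ccoord c @` cdom c) y -> nbhs y (ccoord c @` cdom c).
Proof. by move=> cp; apply: open_nbhs_nbhs; split=> //; apply: cimage_open. Qed.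

Lemma cimage_coord (T : topologicalType) n (c : chart R T n) p :
  cdom c p -> (ccoord c @` cdom c) (ccoord c p).
Proof. by move=> cp; exists p. Qed.

Lemma paramK (T : topologicalType) n (c : chart R T n) y :
  (ccoord c @` cdom c) y -> ccoord c (cparam c y) = y.
Proof. by move=> [p cp <-]; rewrite coordK. Qed.

Lemma smooth_at_chart V P (x : V) (a : V -> P) : msmooth_at x a ->
  smooth_at x (fun y => ccoord (chart_at (a x)) (a y)).
Proof. by case=> _; apply; [exact: chart_at_atlas|exact: chart_at_dom]. Qed.

Lemma near_cdom V P (x : V) (a : V -> P) (c : chart R P (mdim P)) :
  {for x, continuous a} -> cdom c (a x) -> \forall y \near x, cdom c (a y).
Proof. by move=> ca cx; apply: ca; apply: nbhs_cdom. Qed.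

Lemma msmooth_at_cst V P (x : V) (p : P) : msmooth_at x (fun=> p).
Proof. by split=> [|c _ _]; [exact: cst_continuous|exact: smooth_at_cst]. Qed.

Lemma msmooth_at_eq V P (x : V) (a b : V -> P) :
  (\forall y \near x, a y = b y) -> msmooth_at x a -> msmooth_at x b.
Proof.
move=> ab [ca sa]; split; first exact: near_eq_continuous ca.
move=> c cA cbx; have := sa c cA; rewrite (nbhs_singleton ab) => /(_ cbx).
by apply: smooth_at_eq; apply: filterS ab => y ->.
Qed.

Lemma msmooth_at_param P (c : chart R P (mdim P)) y : atlas c ->
  (ccoord c @` cdom c) y -> msmooth_at y (cparam c).
Proof.
move=> cA cy; split=> [|c' c'A c'y]; first exact: param_continuous.
apply: smooth_on_at (transition_smooth cA c'A).
have := near_cdom (param_continuous cy) c'y.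
apply: filterS2 (nbhs_cimage cy) => z [p cp <-]; rewrite coordK // => c'p.
by exists p.
Qed.

Lemma msmooth_at_comp V P Q (x : V) (f : P -> Q) (a : V -> P) :
  smooth f -> msmooth_at x a -> msmooth_at x (fun y => f (a y)).
Proof.
move=> [cf sf] [ca sa]; split.
  by apply: (continuous_comp ca); apply: cf.
move=> c' c'A c'x; pose c := chart_at (a x).
have cA : atlas c by apply: chart_at_atlas.
have cx : cdom c (a x) by apply: chart_at_dom.
have ss : smooth_at (ccoord c (a x)) (ccoord c' \o f \o cparam c).
  apply: smooth_on_at (sf c c' cA c'A).
  have : \forall z \near ccoord c (a x), cdom c' (f (cparam c z)).
    apply: (near_cdom (a := fun z => f (cparam c z))); last by rewrite coordK.
    by apply: (continuous_comp (param_continuous (cimage_coord cx))); apply: cf.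
  apply: filterS2 (nbhs_cimage (cimage_coord cx)) => z [p cp <-].
  by rewrite coordK // => c'p; exists p.
have := smooth_at_comp (fin_dim_rV _) (sa c cA cx) ss.
apply: smooth_at_eq; apply: filterS (near_cdom ca cx) => y cy /=.
by rewrite coordK.
Qed.

Lemma msmooth_at_comp2 V P Q N (x : V) (f : P -> Q -> N) (a : V -> P) (b : V -> Q) :
  smooth2 f -> msmooth_at x a -> msmooth_at x b ->
  msmooth_at x (fun y => f (a y) (b y)).
Proof.
move=> [cf sf] [ca sa] [cb sb]; split.
  have cab : {for x, continuous (fun y => (a y, b y))} by apply: cvg_pair.
  exact: (@continuous_comp _ _ _ (fun y => (a y, b y))
    (fun z : P * Q => f z.1 z.2) x cab (cf _)).
move=> c'' c''A c''x; pose c := chart_at (a x); pose c' := chart_at (b x).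
have cA : atlas c by apply: chart_at_atlas.
have cx : cdom c (a x) by apply: chart_at_dom.
have c'A : atlas c' by apply: chart_at_atlas.
have c'x : cdom c' (b x) by apply: chart_at_dom.
pose F := fun z : 'rV[R]_(mdim P) * 'rV[R]_(mdim Q) =>
  ccoord c'' (f (cparam c z.1) (cparam c' z.2)).
pose z0 := (ccoord c (a x), ccoord c' (b x)).
have ss : smooth_at z0 F.
  apply: smooth_on_at (sf c c' c'' cA c'A c''A).
  have n1 : \forall z \near z0, (ccoord c @` cdom c) z.1.
    have : fst @ z0 --> z0.1 by exact: cvg_fst.
    by apply; apply: nbhs_cimage; apply: cimage_coord.
  have n2 : \forall z \near z0, (ccoord c' @` cdom c') z.2.
    have : snd @ z0 --> z0.2 by exact: cvg_snd.
    by apply; apply: nbhs_cimage; apply: cimage_coord.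
  have n3 : \forall z \near z0, cdom c'' (f (cparam c z.1) (cparam c' z.2)).
    apply: (near_cdom (a := fun z : 'rV[R]_(mdim P) * 'rV[R]_(mdim Q) =>
      f (cparam c z.1) (cparam c' z.2))); last by rewrite /= !coordK.
    have cp : {for z0, continuous (fun z : 'rV[R]_(mdim P) * 'rV[R]_(mdim Q) =>
        (cparam c z.1, cparam c' z.2))}.
      apply: cvg_pair.
        apply: (@continuous_comp _ _ _ fst (cparam c)); first exact: cvg_fst.
        by apply: param_continuous; apply: cimage_coord.
      apply: (@continuous_comp _ _ _ snd (cparam c')); first exact: cvg_snd.
      by apply: param_continuous; apply: cimage_coord.
    exact: (@continuous_comp _ _ _ (fun z : 'rV[R]_(mdim P) * 'rV[R]_(mdim Q) =>
        (cparam c z.1, cparam c' z.2)) (fun z : P * Q => f z.1 z.2) z0 cp (cf _)).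
  by apply: filterS3 n1 n2 n3 => z z1 z2 z3; split.
have fd : fin_dim ('rV[R]_(mdim P) * 'rV[R]_(mdim Q))%type.
  by apply: fin_dim_prod; apply: fin_dim_rV.
have := smooth_at_comp fd (smooth_at_pair (sa c cA cx) (sb c' c'A c'x)) ss.
apply: smooth_at_eq; apply: filterS2 (near_cdom ca cx) (near_cdom cb c'x) => y cy c'y.
by rewrite /F /= !coordK.
Qed.

Lemma msmooth_at_reparam V W P (x : V) (g : V -> W) (a : W -> P) :
  fin_dim W -> smooth_at x g -> msmooth_at (g x) a -> msmooth_at x (fun y => a (g y)).
Proof.
move=> fW sg [ca sa]; split.
  by apply: continuous_comp ca; apply: smooth_at_continuous.
by move=> c cA cx; apply: smooth_at_comp (sa c cA cx).
Qed.

Lemma mderiv_cst V P (x : V) (p : P) v : mderiv (fun=> p) x v = 0.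
Proof. exact: derive_cst. Qed.

Lemma mderiv_param P (p : P) v :
  mderiv (cparam (chart_at p)) (ccoord (chart_at p) p) v = v.
Proof.
have cp := chart_at_dom p.
rewrite /mderiv coordK // -[RHS](derive_id (ccoord (chart_at p) p) v).
apply: near_eq_derive; apply: filterS (nbhs_cimage (cimage_coord cp)) => y.
exact: paramK.
Qed.

Lemma msmooth_at_param_at P (p : P) :
  msmooth_at (ccoord (chart_at p) p) (cparam (chart_at p)).
Proof.
apply: msmooth_at_param; first exact: chart_at_atlas.
by apply: cimage_coord; apply: chart_at_dom.
Qed.

Lemma smooth_curve_at P (a : R -> P) (t : R) :
  smooth_curve a -> msmooth_at (t : R^o) a.
Proof.
move=> [ca sa]; split=> [|c cA ct]; first exact: ca.
apply: smooth_on_at (sa c cA).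
by apply: (ca t); apply: nbhs_cdom.
Qed.

Lemma velocity0E P (a : R -> P) : velocity0 a = mderiv (a : R^o -> P) 0 1.
Proof. by []. Qed.

(* Smoothness of f at p, required only of f read in [chart_at p] on the source:
   this is what the chain rule [tangent_map_mderiv] uses. *)
Definition smooth_near P Q (f : P -> Q) (p : P) :=
  msmooth_at (ccoord (chart_at p) p) (fun y => f (cparam (chart_at p) y)).

(** Both sides use the same frozen charts, at [a x] and at [f (a x)], so no transition map
    intervenes and this is the chain rule between normed spaces. *)
Lemma tangent_map_mderiv V P Q (f : P -> Q) (a : V -> P) (x v : V) :
  msmooth_at x a -> smooth_near f (a x) ->
  tangent_map f (a x) (mderiv a x v) = mderiv (fun y => f (a y)) x v.
Proof.
move=> sa sf; have cx := chart_at_dom (a x).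
rewrite /tangent_map /mderiv; set c := chart_at (a x); set c' := chart_at (f (a x)).
have df : differentiable (ccoord c' \o f \o cparam c) (ccoord c (a x)).
  have [_ /(_ c' (chart_at_atlas _))] := sf; rewrite coordK //.
  by move=> /(_ (chart_at_dom _))/smooth_at_differentiable.
have da : differentiable (fun y => ccoord c (a y)) x.
  exact/smooth_at_differentiable/smooth_at_chart.
rewrite -(derive_comp v da df); apply: near_eq_derive.
have [ca _] := sa; apply: filterS (near_cdom ca cx) => y cy /=.
by rewrite coordK.
Qed.

End Plots.

(** * Families of linear maps and partial derivatives *)

Section Families.
Context {R : realType}.
Implicit Types (U V W : normedModType R).

Lemma derive_ext V W (f g : V -> W) (x v : V) : f =1 g -> 'D_v f x = 'D_v g x.
Proof. by move=> /funext ->. Qed.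

Lemma smooth_at_ext V W (f g : V -> W) (x : V) : f =1 g -> smooth_at x f -> smooth_at x g.
Proof. by move=> /funext ->. Qed.

Lemma family_sum n W (L : 'rV[R]_n -> W) w : linear L ->
  L w = \sum_i (w 0 i : R^o) *: L (delta_mx 0 i).
Proof.
move=> /linear_pack [L' ->]; rewrite [in LHS](row_sum_delta w) linear_sum.
by apply: eq_bigr => i _; rewrite linearZ.
Qed.

(** A Leibniz rule adapted to [Ad (a y)], whose regularity in y is available for each fixed vector.
    Linearity is asked only near x because in [lie_bracketE] the family is linear only while its
    parameter stays in the chart. The proof expands the vector in coordinates. *)
Lemma derive_family V n W (A : V -> 'rV[R]_n -> W) (f : V -> 'rV[R]_n) x v :
  (\forall y \near x, linear (A y)) -> (forall w, differentiable (A^~ w) x) ->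
  differentiable f x ->
  'D_v (fun y => A y (f y)) x = 'D_v (A^~ (f x)) x + A x ('D_v f x).
Proof.
move=> linA dA df; have linx := nbhs_singleton linA.
have dfi i : differentiable (fun y => f y 0 i : R^o) x.
  exact: (differentiable_comp df (differentiable_linear (f x) (coord_linear i)
    (@coord_continuousV R n i))).
have dterm i := derive_scale (dfi i) (dA (delta_mx 0 i)).
have -> : 'D_v (fun y => A y (f y)) x =
    'D_v (\sum_i (fun y => (f y 0 i : R^o) *: A y (delta_mx 0 i))) x.
  by apply: near_eq_derive; apply: filterS linA => y ly; rewrite fct_sumE family_sum.
have -> : 'D_v (A^~ (f x)) x =
    'D_v (\sum_i (fun y => (f x 0 i : R^o) *: A y (delta_mx 0 i))) x.
  by apply: near_eq_derive; apply: filterS linA => y ly; rewrite fct_sumE -family_sum.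
rewrite !derive_sum.
- rewrite [X in _ = _ + X]family_sum // -big_split; apply: eq_bigr => i _ /=.
  have [_ ->] := dterm i; rewrite deriveZ; last exact/diff_derivable/dA.
  congr (_ + _ *: _).
  exact: (derive_linear_comp v (coord_linear i) (@coord_continuousV R n i) df).
- by move=> i; apply/diff_derivable/differentiableZ/dA.
- by move=> i; apply/diff_derivable; have [] := dterm i.
Qed.

Lemma smooth_at_family V n W (A : V -> 'rV[R]_n -> W) (f : V -> 'rV[R]_n) x :
  (\forall y \near x, linear (A y)) -> (forall w, smooth_at x (A^~ w)) ->
  smooth_at x f -> smooth_at x (fun y => A y (f y)).
Proof.
move=> linA sA sf.
have : smooth_at x (fun y => \sum_i (f y 0 i : R^o) *: A y (delta_mx 0 i)).
  apply: smooth_at_sum => i; apply: smooth_at_scale; first exact: smooth_at_coord.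
  exact: sA.
by apply: smooth_at_eq; apply: filterS linA => y ly; rewrite -family_sum.
Qed.

(** The partial derivative is the derivative of the jointly smooth [F] along [(0, w)], composed with
    y |-> (y, g y). This is how derivatives at the identity, such as [Ad] and [dgprod], become
    smooth in their group parameter. *)
Lemma smooth_at_partial V W W' (F : V * W -> W') (g : V -> W) x w :
  fin_dim V -> fin_dim W -> smooth_at (x, g x) F -> smooth_at x g ->
  smooth_at x (fun y => 'D_w (fun z => F (y, z)) (g y)).
Proof.
move=> fV fW sF sg.
have sp := smooth_at_pair (smooth_at_id x) sg.
have := smooth_at_comp (fin_dim_prod fV fW) sp (smooth_at_derive (0, w) sF).
by apply: smooth_at_eq; near=> y; rewrite derive_pairr.
Unshelve. all: by end_near. Qed.

Lemma smooth_at_fst V W (z : V * W) : smooth_at z fst.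
Proof.
apply: (smooth_at_linear (L := fst : V * W -> V)) (smooth_at_id z) => //.
by move=> ?; apply: cvg_fst.
Qed.

Lemma smooth_at_snd V W (z : V * W) : smooth_at z snd.
Proof.
apply: (smooth_at_linear (L := snd : V * W -> W)) (smooth_at_id z) => //.
by move=> ?; apply: cvg_snd.
Qed.

(** Near x the plot factors through the fixed chart at [a x]: it is [cparam] after a smooth
    coordinate map, and [cparam] is smooth with respect to every other chart. *)
Lemma msmooth_at_near V (P : manifold R) (x : V) (a : V -> P) :
  msmooth_at x a -> \forall y \near x, msmooth_at y a.
Proof.
move=> sa; have [ca _] := sa; set c := chart_at (a x).
have cx : cdom c (a x) by apply: chart_at_dom.
have ncx := near_cdom ca cx.
have : \forall y \near x, \forall z \near y, cdom c (a z) by apply: near_join.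
apply: filterS2 (smooth_at_near (smooth_at_chart sa)) => y sy cy.
have cay := nbhs_singleton cy.
have sc : msmooth_at (ccoord c (a y)) (cparam c).
  by apply: msmooth_at_param; [exact: chart_at_atlas|exact: cimage_coord].
have := msmooth_at_reparam (fin_dim_rV _) sy sc.
by apply: msmooth_at_eq; apply: filterS cy => z cz; rewrite coordK.
Qed.

End Families.

(** * Lie groups *)

Section LieGroup.
Context {R : realType} (G : lieGroup R).
Implicit Types (V W : normedModType R) (g h : G) (u v w x y z : lieAlg G).

Notation e := (@gone R G).
Notation k := (ccoord (chart_at e)).
Notation E := (cparam (chart_at e)).
Notation o := (ccoord (chart_at e) e).

Lemma gmulgV g : gmul g (ginv g) = e.
Proof.
rewrite -[LHS]gmul1 -{1}(gmulV (ginv g)) -gmulA [gmul (ginv g) (gmul g _)]gmulA.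
by rewrite gmulV gmul1 gmulV.
Qed.

Lemma gmulg1 g : gmul g e = g.
Proof. by rewrite -(gmulV g) gmulA gmulgV gmul1. Qed.

Lemma gmulKg g h : gmul (ginv g) (gmul g h) = h.
Proof. by rewrite gmulA gmulV gmul1. Qed.

Lemma gmulVKg g h : gmul g (gmul (ginv g) h) = h.
Proof. by rewrite gmulA gmulgV gmul1. Qed.

Lemma ginv_unique g h : gmul g h = e -> h = ginv g.
Proof. by move=> gh; rewrite -[RHS]gmulg1 -gh gmulKg. Qed.

Lemma ginvM g h : ginv (gmul g h) = gmul (ginv h) (ginv g).
Proof.
by apply/esym/ginv_unique; rewrite -gmulA gmulVKg gmulgV.
Qed.

Lemma ginvK g : ginv (ginv g) = g.
Proof. by apply/esym/ginv_unique; rewrite gmulV. Qed.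

Lemma ginv1 : ginv e = e.
Proof. by apply/esym/ginv_unique; rewrite gmul1. Qed.

Lemma conjGM g h (p : G) : conjG (gmul g h) p = conjG g (conjG h p).
Proof. by rewrite /conjG ginvM !gmulA. Qed.

Lemma conjG1 (p : G) : conjG e p = p.
Proof. by rewrite /conjG ginv1 gmulg1 gmul1. Qed.

Lemma conjGe g : conjG g e = e.
Proof. by rewrite /conjG gmulg1 gmulgV. Qed.

Section PlotOps.
Context {V : normedModType R} (t : V) (a b : V -> G).
Hypotheses (sa : msmooth_at t a) (sb : msmooth_at t b).

Lemma msmooth_at_mul : msmooth_at t (fun s => gmul (a s) (b s)).
Proof. exact: msmooth_at_comp2 (@gmul_smooth R G) sa sb. Qed.

Lemma msmooth_at_inv : msmooth_at t (fun s => ginv (a s)).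
Proof. exact: msmooth_at_comp (@ginv_smooth R G) sa. Qed.

End PlotOps.

Lemma msmooth_at_conj V (t : V) (a b : V -> G) :
  msmooth_at t a -> msmooth_at t b -> msmooth_at t (fun s => conjG (a s) (b s)).
Proof.
by move=> sa sb; apply: msmooth_at_mul (msmooth_at_mul sa sb) (msmooth_at_inv sa).
Qed.

Lemma smooth_near_lmul g h : smooth_near (gmul g) h.
Proof. exact: msmooth_at_mul (msmooth_at_cst _ g) (msmooth_at_param_at h). Qed.

Lemma smooth_near_rmul g h : smooth_near (fun p => gmul p g) h.
Proof. exact: msmooth_at_mul (msmooth_at_param_at h) (msmooth_at_cst _ g). Qed.

Lemma smooth_near_conj g h : smooth_near (conjG g) h.
Proof. exact: msmooth_at_conj (msmooth_at_cst _ g) (msmooth_at_param_at h). Qed.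

Lemma thetaL_mderiv V (a : V -> G) (t s : V) : msmooth_at t a ->
  thetaL (a t) (mderiv a t s) = mderiv (fun r => gmul (ginv (a t)) (a r)) t s.
Proof. by move=> sa; apply: tangent_map_mderiv => //; apply: smooth_near_lmul. Qed.

Lemma thetaR_mderiv V (a : V -> G) (t s : V) : msmooth_at t a ->
  thetaR (a t) (mderiv a t s) = mderiv (fun r => gmul (a r) (ginv (a t))) t s.
Proof.
move=> sa; rewrite /thetaR.
rewrite (tangent_map_mderiv (f := fun h : G => gmul h (ginv (a t)))) //.
exact: smooth_near_rmul.
Qed.

Lemma Ad_mderiv V (a : V -> G) (t s : V) g : msmooth_at t a -> a t = e ->
  Ad g (mderiv a t s) = mderiv (fun r => conjG g (a r)) t s.
Proof.
move=> sa at1; have H := tangent_map_mderiv s sa (smooth_near_conj g (a t)).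
by rewrite at1 in H.
Qed.

Lemma tangent_conj V (a : V -> G) (t s : V) g : msmooth_at t a ->
  tangent_map (conjG g) (a t) (mderiv a t s) = mderiv (fun r => conjG g (a r)) t s.
Proof. by move=> sa; rewrite tangent_map_mderiv //; apply: smooth_near_conj. Qed.

Lemma msmooth_at_chart1 : msmooth_at o E.
Proof. exact: msmooth_at_param_at. Qed.

Lemma param_chart1 : E o = e.
Proof. by rewrite coordK //; apply: chart_at_dom. Qed.

Lemma mderiv_chart1 w : mderiv E o w = w.
Proof. exact: mderiv_param. Qed.

Lemma mderiv1E V (a : V -> G) (t s : V) : a t = e ->
  mderiv a t s = 'D_s (fun r => k (a r)) t.
Proof. by rewrite /mderiv => ->. Qed.

Lemma mderiv_ext V (P : manifold R) (a b : V -> P) (t s : V) :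
  a =1 b -> mderiv a t s = mderiv b t s.
Proof. by move=> /funext ->. Qed.

Lemma AdE g w : Ad g w = 'D_w (fun z => k (conjG g (E z))) o.
Proof. by rewrite /Ad /tangent_map conjGe. Qed.

Lemma tangent_map_linear (P Q : manifold R) (f : P -> Q) p :
  smooth_near f p -> linear (tangent_map f p).
Proof.
move=> sf; apply: derive_vec_linear.
have := smooth_at_differentiable (smooth_at_chart sf).
by rewrite coordK //; apply: chart_at_dom.
Qed.

Lemma Ad_linear g : linear (Ad g).
Proof. exact/tangent_map_linear/smooth_near_conj. Qed.

Lemma thetaL_linear g : linear (thetaL g).
Proof. exact/tangent_map_linear/smooth_near_lmul. Qed.

Lemma thetaR_linear g : linear (thetaR g).
Proof. exact: (tangent_map_linear (smooth_near_rmul (ginv g) g)). Qed.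

Lemma Ad_mderivE g w : Ad g w = mderiv (fun z => conjG g (E z)) o w.
Proof. by rewrite AdE mderiv1E // param_chart1 conjGe. Qed.

Lemma AdM g h w : Ad (gmul g h) w = Ad g (Ad h w).
Proof.
have he : conjG h (E o) = e by rewrite param_chart1 conjGe.
have H := Ad_mderiv w g (smooth_near_conj h e) he.
rewrite Ad_mderivE (Ad_mderivE h w) H.
by apply: mderiv_ext => z; rewrite conjGM.
Qed.

Lemma Ad1 w : Ad e w = w.
Proof.
rewrite Ad_mderivE -[RHS]mderiv_chart1.
by apply: mderiv_ext => z; rewrite conjG1.
Qed.

Lemma AdK g w : Ad g (Ad (ginv g) w) = w.
Proof. by rewrite -AdM gmulgV Ad1. Qed.

Lemma smooth_at_chart1 V (a : V -> G) (t : V) : msmooth_at t a -> a t = e ->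
  smooth_at t (fun s => k (a s)).
Proof. by move=> /smooth_at_chart + ae; rewrite ae. Qed.

Lemma near_chart1K V (a : V -> G) (t : V) : msmooth_at t a -> a t = e ->
  \forall s \near t, cdom (chart_at e) (a s) /\ E (k (a s)) = a s.
Proof.
move=> [ca _] ae.
have : \forall s \near t, cdom (chart_at e) (a s).
  by apply: near_cdom => //; rewrite ae; apply: chart_at_dom.
by apply: filterS => s cs; rewrite coordK.
Qed.

Lemma msmooth_at_E2 :
  msmooth_at (o, o) (fun z : 'rV[R]_(mdim G) * 'rV[R]_(mdim G) => gmul (E z.1) (E z.2)).
Proof.
apply: msmooth_at_mul.
  by apply: (msmooth_at_reparam (fin_dim_rV _) (smooth_at_fst _)); apply: msmooth_at_chart1.
by apply: (msmooth_at_reparam (fin_dim_rV _) (smooth_at_snd _)); apply: msmooth_at_chart1.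
Qed.

Definition gprod (z : 'rV[R]_(mdim G) * 'rV[R]_(mdim G)) : 'rV[R]_(mdim G) :=
  k (gmul (E z.1) (E z.2)).

Lemma smooth_at_gprod : smooth_at (o, o) gprod.
Proof. by apply: smooth_at_chart1 msmooth_at_E2 _; rewrite /= param_chart1 gmul1. Qed.

Lemma derive_chart1 w : 'D_w (fun z => k (E z)) o = w.
Proof. by rewrite -[RHS]mderiv_chart1 mderiv1E // param_chart1. Qed.

Lemma derive_gprodl u : 'D_(u, 0) gprod (o, o) = u.
Proof.
apply: etrans (esym (derive_pairl gprod o o u)) _; rewrite -[RHS]derive_chart1.
by apply: derive_ext => z; rewrite /gprod /= param_chart1 gmulg1.
Qed.

Lemma derive_gprodr u : 'D_(0, u) gprod (o, o) = u.
Proof.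
apply: etrans (esym (derive_pairr gprod o o u)) _; rewrite -[RHS]derive_chart1.
by apply: derive_ext => z; rewrite /gprod /= param_chart1 gmul1.
Qed.

(** The differential of the product at the identity pair is addition: it is linear, and on each
    factor it restricts to the identity. *)
Lemma mderivM V (a b : V -> G) (t s : V) :
  msmooth_at t a -> msmooth_at t b -> a t = e -> b t = e ->
  mderiv (fun r => gmul (a r) (b r)) t s = mderiv a t s + mderiv b t s.
Proof.
move=> sa sb ae be; rewrite !mderiv1E ?ae ?be ?gmul1 //.
have ska := smooth_at_differentiable (smooth_at_chart1 sa ae).
have skb := smooth_at_differentiable (smooth_at_chart1 sb be).
have dF := smooth_at_differentiable smooth_at_gprod.
have -> : 'D_s (fun r => k (gmul (a r) (b r))) t =
          'D_s (gprod \o (fun r => (k (a r), k (b r)))) t.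
  apply: near_eq_derive; apply: filterS2 (near_chart1K sa ae) (near_chart1K sb be) => r.
  by move=> [_ Ea] [_ Eb]; rewrite /gprod /= Ea Eb.
have dab := differentiable_pair ska skb.
rewrite derive_comp ?ae ?be // derive_pair //=.
rewrite ?ae ?be.
set u := 'D_s _ _; set v := 'D_s _ _.
have -> : (u, v) = (u, 0) + (0, v).
  by congr (_, _); rewrite /= ?addr0 ?add0r.
exact: etrans (derive_vecD _ _ dF) (congr2 +%R (derive_gprodl u) (derive_gprodr v)).
Qed.

Lemma mderivV V (a : V -> G) (t s : V) : msmooth_at t a -> a t = e ->
  mderiv (fun r => ginv (a r)) t s = - mderiv a t s.
Proof.
move=> sa ae; apply/eqP; rewrite -addr_eq0 addrC; apply/eqP.
rewrite -mderivM //; last by rewrite ae ginv1.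
  rewrite -[RHS](mderiv_cst t e s).
  by apply: mderiv_ext => r; rewrite gmulgV.
exact: msmooth_at_inv.
Qed.

End LieGroup.

(** * The adjoint action and the Lie bracket *)

Section Bracket.
Context {R : realType} (G : lieGroup R).
Implicit Types (V W : normedModType R) (g h : G) (u v w x y z : lieAlg G).

Notation e := (@gone R G).
Notation k := (ccoord (chart_at e)).
Notation E := (cparam (chart_at e)).
Notation o := (ccoord (chart_at e) e).

Lemma rV_linear_cont W (L : lieAlg G -> W) : linear L -> continuous L.
Proof. exact: rV_linear_continuous. Qed.

(** [Ad (a s) w] is the partial derivative along w, at the identity, of conjugation seen as a smooth
    function of both variables. *)
Lemma smooth_at_Ad V (t : V) (a : V -> G) w : fin_dim V ->
  msmooth_at t a -> smooth_at t (fun s => Ad (a s) w : 'rV[R]_(mdim G)).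
Proof.
move=> fV sa.
have sF : smooth_at (t, o) (fun z : V * 'rV[R]_(mdim G) => k (conjG (a z.1) (E z.2))).
  apply: smooth_at_chart1; last by rewrite /= param_chart1 conjGe.
  apply: msmooth_at_conj.
    by apply: (msmooth_at_reparam fV (smooth_at_fst _)); apply: sa.
  by apply: (msmooth_at_reparam (fin_dim_rV _) (smooth_at_snd _)); apply: msmooth_at_chart1.
have := smooth_at_partial (g := fun=> o) w fV (fin_dim_rV _) sF (smooth_at_cst _ _).
by apply: smooth_at_ext => s; rewrite AdE.
Qed.

Lemma derive_Ad1 V (t s : V) (a : V -> G) w : msmooth_at t a -> a t = e ->
  'D_s (fun r => Ad (a r) w : 'rV[R]_(mdim G)) t = lie_bracket (mderiv a t s) w.
Proof.
move=> sa ae.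
have dk := smooth_at_differentiable (smooth_at_chart1 sa ae).
have dAd : differentiable (fun z => Ad (E z) w : 'rV[R]_(mdim G)) (k (a t)).
  by rewrite ae; apply: smooth_at_differentiable;
    apply: smooth_at_Ad (fin_dim_rV _) (msmooth_at_chart1 G).
have H := derive_comp s dk dAd; rewrite /= ae in H.
rewrite (mderiv1E s ae); apply: etrans _ H; apply: near_eq_derive.
by apply: filterS (near_chart1K sa ae) => r [_ Er]; rewrite /= Er.
Qed.

(** Factoring [Ad (a r)] as [Ad (a t)] after [Ad] of (a t)^-1 (a r) moves the base point to the
    identity, where [derive_Ad1] applies; the velocity of the translated plot is [thetaL]. *)
Lemma derive_Ad V (t s : V) (a : V -> G) w : fin_dim V -> msmooth_at t a ->
  'D_s (fun r => Ad (a r) w : 'rV[R]_(mdim G)) t =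
  Ad (a t) (lie_bracket (thetaL (a t) (mderiv a t s)) w).
Proof.
move=> fV sa; rewrite thetaL_mderiv //.
have sb : msmooth_at t (fun r => gmul (ginv (a t)) (a r)).
  exact: msmooth_at_mul (msmooth_at_cst _ _) sa.
have := derive_Ad1 s w sb (gmulV _) => <-.
have dAd := smooth_at_differentiable (smooth_at_Ad w fV sb).
apply: etrans _ (derive_linear_comp s (Ad_linear (a t))
  (rV_linear_cont (Ad_linear (a t))) dAd).
by apply: derive_ext => r; rewrite /= -AdM gmulVKg.
Qed.

Lemma dAdE w : differentiable (fun z => Ad (E z) w : 'rV[R]_(mdim G)) o.
Proof. exact: smooth_at_differentiable (smooth_at_Ad w (fin_dim_rV _) (msmooth_at_chart1 G)). Qed.

Lemma lie_bracket_linearl w : linear (fun u => lie_bracket u w).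
Proof. exact: derive_vec_linear (dAdE w). Qed.

Lemma lie_bracket_linearr u : linear (lie_bracket u).
Proof.
move=> a v w; rewrite /lie_bracket.
rewrite -deriveZ; last exact/diff_derivable/dAdE.
rewrite -deriveD.
- by apply: derive_ext => z; rewrite Ad_linear.
- exact/diff_derivable/differentiableZ/dAdE.
- exact/diff_derivable/dAdE.
Qed.

(** Differentiate Ad_g Ad_h w = Ad_(g h g^-1) Ad_g w in h at the identity along u. *)
Lemma Ad_bracket g u w : Ad g (lie_bracket u w) = lie_bracket (Ad g u) (Ad g w).
Proof.
rewrite (Ad_mderivE g u).
have H := derive_Ad1 u (Ad g w) (smooth_near_conj g e).
rewrite -H; last by rewrite param_chart1 conjGe.
apply: etrans (esym (derive_linear_comp u (Ad_linear g)
  (rV_linear_cont (Ad_linear g)) (dAdE w))) _.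
by apply: derive_ext => z; rewrite /= -!AdM /conjG -!gmulA gmulV gmulg1.
Qed.

(** The derivative of [Ad_bracket] in its group variable, at the identity along z. With antisymmetry
    it becomes the Jacobi identity. *)
Lemma lie_bracket_deriv x y z :
  lie_bracket z (lie_bracket x y) =
  lie_bracket (lie_bracket z x) y + lie_bracket x (lie_bracket z y).
Proof.
rewrite {1}/lie_bracket.
have := derive_bilinear z lie_bracket_linearl lie_bracket_linearr (dAdE x) (dAdE y).
rewrite param_chart1 !Ad1 => <-.
by apply: derive_ext => t; rewrite Ad_bracket.
Qed.

(* The mixed second derivative at (e, e) of the product, in the chart at e; it is
   chart-dependent, but its antisymmetrisation is the bracket. *)
Definition dgprod (u w : 'rV[R]_(mdim G)) : 'rV[R]_(mdim G) :=
  'D_u (fun p => 'D_w (fun q => k (gmul (E p) (E q))) o) o.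

Lemma smooth_at_dgprod w :
  smooth_at o (fun p => 'D_w (fun q => k (gmul (E p) (E q))) o).
Proof.
exact: (smooth_at_partial (g := fun=> o) w (fin_dim_rV _) (fin_dim_rV _)
  (@smooth_at_gprod R G) (smooth_at_cst _ _)).
Qed.

Lemma dgprodE u w :
  dgprod u w = 'D_(u, 0) (fun p => 'D_(0, w) (@gprod R G) p) (o, o).
Proof.
apply: etrans _ (derive_pairl _ o o u); apply: derive_ext => p.
exact: (derive_pairr (@gprod R G)).
Qed.

Lemma dgprod_linearl w : linear (dgprod^~ w).
Proof. exact/derive_vec_linear/smooth_at_differentiable/smooth_at_dgprod. Qed.

(** Only the order of differentiation changes: u still acts on the left factor and w on the right
    one. [dgprod] itself is not symmetric in general, its antisymmetric part being the bracket. *)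
Lemma dgprod_swap u w :
  dgprod u w = 'D_w (fun q => 'D_u (fun p => k (gmul (E p) (E q))) o) o.
Proof.
rewrite dgprodE derive_swap; last exact: smooth_at_gprod.
apply: etrans (esym (derive_pairr _ o o w)) _; apply: derive_ext => p.
exact/esym/(derive_pairl (@gprod R G)).
Qed.

Lemma differentiable_kmull g : cdom (chart_at e) g ->
  differentiable (fun q => k (gmul (E q) g)) o.
Proof.
move=> cg; have [_ H] := msmooth_at_mul (msmooth_at_chart1 G) (msmooth_at_cst o g).
apply: smooth_at_differentiable; apply: H; first exact: chart_at_atlas.
by rewrite param_chart1 gmul1.
Qed.

Lemma differentiable_kmulr g : cdom (chart_at e) g ->
  differentiable (fun q => k (gmul g (E q))) o.
Proof.
move=> cg; have [_ H] := msmooth_at_mul (msmooth_at_cst o g) (msmooth_at_chart1 G).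
apply: smooth_at_differentiable; apply: H; first exact: chart_at_atlas.
by rewrite param_chart1 gmulg1.
Qed.

Lemma near_cdomE : \forall p \near o, cdom (chart_at e) (E p).
Proof. by apply: filterS (near_chart1K (msmooth_at_chart1 G) (@param_chart1 R G)) => p []. Qed.

(* Differentiate [conjG a b * a = a * b] in [b] at [e], then in [a] at [e]. *)
Lemma lie_bracketE u w : lie_bracket u w = dgprod u w - dgprod w u.
Proof.
have E1 : \forall p \near o, 'D_w (fun q => k (gmul (E p) (E q))) o =
    'D_(Ad (E p) w) (fun q => k (gmul (E q) (E p))) o.
  apply: filterS near_cdomE => p cp.
  have sc := smooth_near_conj (E p) e; have ce : conjG (E p) (E o) = e.
    by rewrite param_chart1 conjGe.
  have dk := smooth_at_differentiable (smooth_at_chart1 sc ce).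
  have dm := differentiable_kmull cp.
  have dm' : differentiable (fun q => k (gmul (E q) (E p))) (k (conjG (E p) (E o))).
    by rewrite ce.
  have := derive_comp w dk dm'; rewrite /= ce -AdE => <-.
  apply: near_eq_derive; apply: filterS (near_chart1K sc ce) => q [_ Eq].
  by rewrite /= Eq /conjG -gmulA gmulV gmulg1.
rewrite {1}/dgprod (near_eq_derive _ E1).
pose A (p x : 'rV[R]_(mdim G)) : 'rV[R]_(mdim G) :=
  'D_x (fun q => k (gmul (E q) (E p))) o.
have linA : \forall p \near o, linear (A p).
  by apply: filterS near_cdomE => p cp; apply/derive_vec_linear/differentiable_kmull.
have sA x : smooth_at o (A^~ x).
  have := smooth_at_comp (f := fun r => 'D_(x, 0) (@gprod R G) r)
    (fin_dim_prod (fin_dim_rV _) (fin_dim_rV _))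
    (smooth_at_pair (smooth_at_cst o o) (smooth_at_id o))
    (smooth_at_derive _ (@smooth_at_gprod R G)).
  apply: smooth_at_ext => p.
  exact/esym/(derive_pairl (@gprod R G)).
have := derive_family u linA (fun x => smooth_at_differentiable (sA x)) (dAdE w).
rewrite param_chart1 Ad1 {1}/A => ->.
rewrite dgprod_swap /A addrC addKr.
rewrite -[LHS]derive_chart1; apply: derive_ext => q; by rewrite param_chart1 gmulg1.
Qed.

Lemma lie_bracketC u w : lie_bracket u w = - lie_bracket w u.
Proof. by rewrite !lie_bracketE opprB. Qed.

Lemma jacobi x y z : lie_bracket x (lie_bracket y z) +
  lie_bracket y (lie_bracket z x) + lie_bracket z (lie_bracket x y) = 0.
Proof.
rewrite (lie_bracket_deriv x y z) [lie_bracket (lie_bracket z x) y]lie_bracketC.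
rewrite [lie_bracket z y]lie_bracketC.
have [L EL] := linear_pack (lie_bracket_linearr x).
by rewrite EL linearN addrA addrK subrr.
Qed.

End Bracket.

(** The bookkeeping of [maurer_cartanL]: [a] and [a'] are the two orders of a second derivative of
    [ldiv], [b] and [b'] the two values of [dgprod], and [c] the bracket. *)
Lemma sub_shifted (A : zmodType) (d d' a a' b b' c : A) :
  d = a - b -> d' = a' - b' -> a = a' -> c = b - b' -> d - d' = - c.
Proof. by move=> -> -> -> ->; rewrite opprD addrACA subrr add0r opprK opprB addrC. Qed.

(** The bookkeeping of [maurer_cartanR]: differentiating [Ad] yields two copies of the bracket [c],
    and the equation for [thetaL] removes one. *)
Lemma sub_skew (A : zmodType) (d d' c c' : A) :
  d - d' = - c -> c' = - c -> (c + d) - (c' + d') = c.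
Proof. by move=> E ->; rewrite opprD opprK addrACA E addrK. Qed.

(** * Maurer-Cartan equations and fundamental fields of conjugation *)

Section MaurerCartan.
Context {R : realType} (G : lieGroup R).
Implicit Types (g h : G) (u v w x y z : lieAlg G).

Notation e := (@gone R G).
Notation k := (ccoord (chart_at e)).
Notation E := (cparam (chart_at e)).
Notation o := (ccoord (chart_at e) e).

Lemma param_coord g : cparam (chart_at g) (ccoord (chart_at g) g) = g.
Proof. by rewrite coordK //; apply: chart_at_dom. Qed.

(** Every tangent vector at g is the velocity of the chart parametrisation, so identities between
    tangent vectors may be checked on plots, where [thetaL_mderiv] and its analogues compute. *)
Lemma mderivP g (P : 'rV[R]_(mdim G) -> Prop) :
  (forall (a : 'rV[R]_(mdim G) -> G) (t s : 'rV[R]_(mdim G)),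
     msmooth_at t a -> a t = g -> P (mderiv a t s)) -> forall w, P w.
Proof.
move=> H w; rewrite -(mderiv_param g w).
by apply: H (param_coord g); apply: msmooth_at_param_at.
Qed.

Lemma thetaR_Ad g w : thetaR g w = Ad g (thetaL g w).
Proof.
move: w; apply: (mderivP (g := g)) => a t s sa <-.
have sb := msmooth_at_mul (msmooth_at_cst t (ginv (a t))) sa.
rewrite (thetaR_mderiv s sa) (thetaL_mderiv s sa) (Ad_mderiv s _ sb (gmulV _)).
by apply: mderiv_ext => r; rewrite /conjG gmulVKg.
Qed.

(** Conjugation by g turns left division into its conjugate: (g h g^-1)^-1 (g r g^-1) = g (h^-1 r)
    g^-1. *)
Lemma thetaL_conj g h w :
  thetaL (conjG g h) (tangent_map (conjG g) h w) = Ad g (thetaL h w).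
Proof.
move: w; apply: (mderivP (g := h)) => a t s sa <-.
have sb := msmooth_at_mul (msmooth_at_cst t (ginv (a t))) sa.
have sc := msmooth_at_conj (msmooth_at_cst t g) sa.
rewrite (tangent_conj s g sa) (thetaL_mderiv s sa) (Ad_mderiv s _ sb (gmulV _)).
apply: etrans (thetaL_mderiv s sc) _.
by apply: mderiv_ext => r; rewrite /conjG !ginvM ginvK -!gmulA gmulKg.
Qed.

Lemma thetaR_conj g h w :
  thetaR (conjG g h) (tangent_map (conjG g) h w) = Ad g (thetaR h w).
Proof.
have H1 := thetaR_Ad (conjG g h) (tangent_map (conjG g) h w).
have H2 := congr1 (Ad (conjG g h)) (thetaL_conj g h w).
have H3 : gmul (conjG g h) g = gmul g h.
  by rewrite /conjG -[LHS]gmulA gmulV gmulg1.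
have H4 := AdM (conjG g h) g (thetaL h w); rewrite H3 in H4.
have H5 := congr1 (Ad g) (thetaR_Ad h w).
exact: etrans H1 (etrans H2 (etrans (esym H4) (etrans (AdM g h _) (esym H5)))).
Qed.

Section Plot.
Context {V : normedModType R} (fV : fin_dim V).

(* The components of a^* thetaL and a^* thetaR along the constant field s. *)
Definition pullL (a : V -> G) (s t : V) : 'rV[R]_(mdim G) :=
  thetaL (a t) (mderiv a t s).

Definition pullR (a : V -> G) (s t : V) : 'rV[R]_(mdim G) :=
  thetaR (a t) (mderiv a t s).

(** In the pullback of [thetaL] the point occurs twice, inverted and differentiated. Giving the two
    occurrences separate variables makes [pullL] a partial derivative on the diagonal ([pullLE]). *)
Definition ldiv (a : V -> G) (z : V * V) : 'rV[R]_(mdim G) :=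
  k (gmul (ginv (a z.1)) (a z.2)).

Lemma smooth_at_ldiv (a : V -> G) t : msmooth_at t a -> smooth_at (t, t) (ldiv a).
Proof.
move=> sa; apply: smooth_at_chart1; last by rewrite /= gmulV.
apply: msmooth_at_mul.
  by apply: msmooth_at_inv; apply: (msmooth_at_reparam fV (smooth_at_fst _)).
exact: (msmooth_at_reparam fV (smooth_at_snd _)).
Qed.

Lemma pullLE (a : V -> G) s t : msmooth_at t a ->
  pullL a s t = 'D_(0, s) (ldiv a) (t, t).
Proof.
move=> sa; rewrite /pullL (thetaL_mderiv s sa).
rewrite (mderiv1E (a := fun r => gmul (ginv (a t)) (a r)) s (gmulV (a t))).
exact: (derive_pairr (ldiv a)).
Qed.

Lemma smooth_at_pullL (a : V -> G) s t : msmooth_at t a -> smooth_at t (pullL a s).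
Proof.
move=> sa; have := smooth_at_comp (fin_dim_prod fV fV)
  (smooth_at_pair (smooth_at_id t) (smooth_at_id t))
  (smooth_at_derive (0, s) (smooth_at_ldiv sa)).
apply: smooth_at_eq; apply: filterS (msmooth_at_near sa) => r sr.
by rewrite pullLE.
Qed.

Lemma pullRE (a : V -> G) s t : pullR a s t = Ad (a t) (pullL a s t).
Proof. exact: thetaR_Ad. Qed.

Lemma smooth_at_pullR (a : V -> G) s t : msmooth_at t a -> smooth_at t (pullR a s).
Proof.
move=> sa.
have linA : \forall y \near t, linear (Ad (a y) : _ -> 'rV[R]_(mdim G)).
  by apply: filterE => y; apply: Ad_linear.
have := smooth_at_family linA (fun w => smooth_at_Ad w fV sa) (smooth_at_pullL s sa).
by apply: smooth_at_ext => r; rewrite pullRE.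
Qed.

(** No second derivative of [a] or [b] appears, because p enters only through [a] and q only through
    [b]. *)
Lemma mixed_dgprod (a b : V -> G) (t s s' : V) :
  msmooth_at t a -> msmooth_at t b -> a t = e -> b t = e ->
  'D_s (fun p => 'D_s' (fun q => k (gmul (a p) (b q))) t) t =
  dgprod (mderiv a t s) (mderiv b t s').
Proof.
move=> sa sb ae be; set w := mderiv b t s'.
pose M (p : 'rV[R]_(mdim G)) : 'rV[R]_(mdim G) :=
  'D_w (fun q => k (gmul (E p) (E q))) o.
have dk := smooth_at_differentiable (smooth_at_chart1 sa ae).
have dkb := smooth_at_differentiable (smooth_at_chart1 sb be).
have dM : differentiable M (k (a t)).
  by rewrite ae; apply: smooth_at_differentiable; apply: smooth_at_dgprod.
have H := derive_comp s dk dM; rewrite /= ae in H.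
rewrite (mderiv1E s ae); apply: etrans _ H.
apply: near_eq_derive; apply: filterS (near_chart1K sa ae) => y [cay Eay].
have dm : differentiable (fun q => k (gmul (a y) (E q))) (k (b t)).
  by rewrite be; apply: differentiable_kmulr.
have H' := derive_comp s' dkb dm; rewrite /= be in H'.
rewrite /M /= Eay /w (mderiv1E s' be); apply: etrans _ H'.
by apply: near_eq_derive; apply: filterS (near_chart1K sb be) => z [_ Eb]; rewrite /= Eb.
Qed.

(** Left translation by (a t)^-1 leaves [ldiv] unchanged and makes the plot pass through the
    identity; the sign is that of the derivative of the inverse there. *)
Lemma derive_ldiv (a : V -> G) (t s s' : V) : msmooth_at t a ->
  'D_(s, 0) (fun r => 'D_(0, s') (ldiv a) r) (t, t) =
  - dgprod (pullL a s t) (pullL a s' t).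
Proof.
move=> sa; pose b r := gmul (ginv (a t)) (a r).
have sb : msmooth_at t b by apply: msmooth_at_mul (msmooth_at_cst _ _) sa.
have be : b t = e by apply: gmulV.
have sbi := msmooth_at_inv sb.
have bie : ginv (b t) = e by rewrite be ginv1.
have bE r : pullL a r t = mderiv b t r by exact: thetaL_mderiv.
have [L EL] := linear_pack (dgprod_linearl (pullL a s' t)).
have -> : - dgprod (pullL a s t) (pullL a s' t) =
          dgprod (- pullL a s t) (pullL a s' t).
  rewrite -[dgprod (- _) _]/((fun u => dgprod u _) _).
  by rewrite -[dgprod (pullL a s t) _]/((fun u => dgprod u _) _) EL linearN.
rewrite !bE -(mderivV s sb be) -(mixed_dgprod s s' sbi sb bie be).
apply: etrans (esym (derive_pairl _ t t s)) _; apply: derive_ext => y.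
apply: etrans (esym (derive_pairr (ldiv a) y t s')) _; apply: derive_ext => z.
by rewrite /ldiv /b /= ginvM ginvK -gmulA gmulVKg.
Qed.

(** The derivative along the diagonal splits by (r, r) = (0, r) + (r, 0). The first part is a second
    derivative in the second variable alone, symmetric in s and s', so it cancels; the second part
    is minus [dgprod], whose antisymmetrisation is the bracket. *)
Lemma maurer_cartanL (a : V -> G) (t s s' : V) : msmooth_at t a ->
  'D_s (pullL a s') t - 'D_s' (pullL a s) t =
  - lie_bracket (pullL a s t) (pullL a s' t).
Proof.
move=> sa.
have sl := smooth_at_ldiv sa.
have DE r r' : 'D_r (pullL a r') t =
   'D_(0, r) (fun q => 'D_(0, r') (ldiv a) q) (t, t) -
   dgprod (pullL a r t) (pullL a r' t).
  have -> : 'D_r (pullL a r') t =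
            'D_r ((fun q => 'D_(0, r') (ldiv a) q) \o (fun q => (q, q))) t.
    apply: near_eq_derive; apply: filterS (msmooth_at_near sa) => y sy.
    by rewrite /= pullLE.
  have dF := smooth_at_differentiable (smooth_at_derive (0, r') sl).
  have did := smooth_at_differentiable (smooth_at_id t).
  rewrite (derive_comp r (differentiable_pair did did) dF) derive_pair // derive_id.
  have -> : (r, r) = (0, r) + (r, 0) by congr (_, _); rewrite /= ?addr0 ?add0r.
  by rewrite derive_vecD // derive_ldiv.
have SW := derive_swap (0, s) (0, s') sl.
exact: sub_shifted (DE s s') (DE s' s) SW (lie_bracketE _ _).
Qed.

Lemma derive_pullR (a : V -> G) (t s s' : V) : msmooth_at t a ->
  'D_s (pullR a s') t =
  Ad (a t) (lie_bracket (pullL a s t) (pullL a s' t) + 'D_s (pullL a s') t).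
Proof.
move=> sa.
have linA : \forall y \near t, linear (Ad (a y) : _ -> 'rV[R]_(mdim G)).
  by apply: filterE => y; apply: Ad_linear.
have H := derive_family s linA
  (fun w => smooth_at_differentiable (smooth_at_Ad w fV sa))
  (smooth_at_differentiable (smooth_at_pullL s' sa)).
have H1 := derive_Ad s (pullL a s' t) fV sa.
have H2 : 'D_s (pullR a s') t = 'D_s (fun q => Ad (a q) (pullL a s' q)) t.
  by apply: derive_ext => y; rewrite pullRE.
have H3 := congr1 (fun q => q + Ad (a t) ('D_s (pullL a s') t)) H1.
exact: etrans H2 (etrans H (etrans H3 (esym (is_linearD (Ad_linear (a t)) _ _)))).
Qed.

(** The right-hand side is the bracket of the [pullR] values. It is kept as [Ad] of a bracket
    because [extd_theta_pairing] moves that [Ad] across the inner product. *)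
Lemma maurer_cartanR (a : V -> G) (t s s' : V) : msmooth_at t a ->
  'D_s (pullR a s') t - 'D_s' (pullR a s) t =
  Ad (a t) (lie_bracket (pullL a s t) (pullL a s' t)).
Proof.
move=> sa; have H1 := derive_pullR s s' sa; have H2 := derive_pullR s' s sa.
have H3 := maurer_cartanL s s' sa.
have H4 := lie_bracketC (pullL a s' t) (pullL a s t).
apply: etrans (congr2 (fun x y => x - y) H1 H2) _.
apply: etrans (esym (is_linearB (Ad_linear (a t)) _ _)) (congr1 (Ad (a t)) _).
exact: sub_skew H3 H4.
Qed.

End Plot.

Lemma expG_plot (expG : lieAlg G -> G) x : is_exponential expG ->
  let a := fun t : R^o => expG (- (t *: x)) in
  [/\ msmooth_at 0 a, a 0 = e & mderiv a 0 1 = - x].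
Proof.
move=> /(_ (- x)) [sc add0 vel] a.
have aE : a = fun t : R^o => expG (t *: (- x)).
  by apply/funext => t; rewrite /a scalerN.
rewrite aE; split.
- exact: smooth_curve_at sc.
(* A homomorphism sends 0 to an idempotent, and the only idempotent of a group is the identity. *)
- set g := (X in X = _); have gg : g = gmul g g.
    by rewrite /g -[in LHS](addr0 (0 : R)) add0.
  by rewrite -(gmulKg g g) -gg gmulV.
- exact: vel.
Qed.

(** Put a(t) = exp(-tx). Left translation by g^-1 turns the orbit a(t) g a(t)^-1 into the product of
    g^-1 a(t) g and a(t)^-1, two curves through the identity with velocities -Ad_(g^-1) x and x. *)
Lemma thetaL_fundamental_conj (expG : lieAlg G -> G) x g : is_exponential expG ->
  thetaL g (fundamental_field expG (@conjG R G) x g) = x - Ad (ginv g) x.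
Proof.
move=> expP; have [sa ae ax] := expG_plot x expP.
set a := fun t : R^o => expG (- (t *: x)) in sa ae ax.
have sb : msmooth_at (0 : R^o) (fun t => conjG (a t) g).
  exact: msmooth_at_conj sa (msmooth_at_cst _ _).
have {}ae : a 0 = e by exact: ae.
have bg : conjG (a 0) g = g by rewrite ae conjG1.
rewrite /fundamental_field velocity0E -[X in thetaL X _]bg.
rewrite (thetaL_mderiv (1 : R^o) sb) bg.
have sc : msmooth_at (0 : R^o) (fun t => conjG (ginv g) (a t)).
  exact: msmooth_at_conj (msmooth_at_cst _ _) sa.
have ce : conjG (ginv g) (a 0) = e by rewrite ae conjGe.
have sd := msmooth_at_inv sa; have de : ginv (a 0) = e by rewrite ae ginv1.
have := mderivM (1 : R^o) sc sd ce de.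
rewrite -(Ad_mderiv _ _ sa ae) (mderivV _ sa ae) ax opprK.
have [L EL] := linear_pack (Ad_linear (ginv g)).
rewrite EL linearN -EL addrC => <-.
by apply: mderiv_ext => t; rewrite /conjG ginvK !gmulA.
Qed.

Lemma thetaR_fundamental_conj (expG : lieAlg G -> G) x g : is_exponential expG ->
  thetaR g (fundamental_field expG (@conjG R G) x g) = Ad g x - x.
Proof.
move=> expP; rewrite thetaR_Ad thetaL_fundamental_conj //.
have [L EL] := linear_pack (Ad_linear g).
by rewrite EL linearB -EL AdK.
Qed.

Section InnerProduct.
Variable ip : lieAlg G -> lieAlg G -> R^o.
Hypotheses (ipP : is_inner_product ip) (ip_inv : Ad_invariant ip).

Lemma ip_linearl y : linear (ip^~ y).
Proof. by case: ipP => H _ _ r x z; apply: H. Qed.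

Lemma ipC x y : ip x y = ip y x.
Proof. by case: ipP. Qed.

Lemma ip_linearr x : linear (ip x).
Proof. by move=> r y z; rewrite ipC [in RHS]ipC [X in _ = _ + X]ipC ip_linearl. Qed.

(** Differentiate [Ad]-invariance at the identity along z. *)
Lemma ip_bracket x y z : ip (lie_bracket z x) y + ip x (lie_bracket z y) = 0.
Proof.
have := derive_bilinear z ip_linearl ip_linearr (dAdE x) (dAdE y).
rewrite param_chart1 !Ad1 => <-.
by rewrite -[RHS](derive_cst (ip x y) o z); apply: derive_ext => t; rewrite ip_inv.
Qed.

Lemma ip_Ad_adjoint g x y : ip (Ad g x) y = ip x (Ad (ginv g) y).
Proof. by rewrite -(ip_inv (ginv g)) -AdM gmulV Ad1. Qed.

End InnerProduct.

End MaurerCartan.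

(** * Differential forms on a Lie group *)

Section Forms.
Context {R : realType}.
Implicit Types P : manifold R.

Lemma size_del (T : Type) i (s : seq T) : (i < size s)%N -> size (del i s) = (size s).-1.
Proof.
move=> si; rewrite /del size_cat size_take size_drop si.
by rewrite -[in RHS](subnKC si).
Qed.

Lemma size_del_neq (T : Type) i (s : seq T) k :
  (i < size s)%N -> size s != k.+1 -> size (del i s) != k.
Proof.
by move=> si; apply: contra_neq => sk; rewrite -sk size_del // prednK //
  (leq_ltn_trans _ si).
Qed.

Section Wedge.
Context {P : manifold R} {W1 W2 : Type} {W : lmodType R}.
Variables (B : W1 -> W2 -> W) (a : P -> 'rV[R]_(mdim P) -> W1) (b : vform P W2).

(** [W2] is a bare type, so the value that plays the role of zero has to be passed as [w0]. *)
Lemma wedge1_size k (w0 : W2) p s :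
  (forall s', size s' != k -> b p s' = w0) -> (forall w, B w w0 = 0) ->
  size s != k.+1 -> wedge1 B a b p s = 0.
Proof.
move=> bk B0 sk; rewrite /wedge1 big1 // => i _.
by rewrite bk ?B0 ?scaler0 // size_del_neq.
Qed.

Lemma wedge1_2 p u v :
  wedge1 B a b p [:: u; v] = B (a p u) (b p [:: v]) - B (a p v) (b p [:: u]).
Proof.
rewrite /wedge1 !big_ord_recl big_ord0 /= /del /=.
by rewrite expr0 expr1 scale1r scaleN1r addr0.
Qed.

Lemma wedge1_3 p u v w :
  wedge1 B a b p [:: u; v; w] = B (a p u) (b p [:: v; w]) -
    B (a p v) (b p [:: u; w]) + B (a p w) (b p [:: u; v]).
Proof.
rewrite /wedge1 !big_ord_recl big_ord0 /= /del /=.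
by rewrite expr0 expr1 /bump /= sqrrN expr1n !scale1r scaleN1r addr0 addrA.
Qed.

End Wedge.

Lemma form_size P k (a : mform P) p s : is_form k a -> size s != k -> a p s = 0.
Proof. by case=> H _ _ _; apply: H. Qed.

Lemma in_chartE P (c : chart R P (mdim P)) (a : mform P) y s :
  in_chart c a y s = a (cparam c y) [seq mderiv (cparam c) y v | v <- s].
Proof. by []. Qed.

Lemma in_chart_size P k (a : mform P) (c : chart R P (mdim P)) y s :
  is_form k a -> size s != k -> in_chart c a y s = 0.
Proof. by move=> fa sk; rewrite in_chartE (form_size _ fa) // size_map. Qed.

(** [is_form] gives smoothness on lists of length k only; on all other lists the function is
    constantly zero. *)
Lemma smooth_at_form P k (a : mform P) (c : chart R P (mdim P)) y s :
  is_form k a -> atlas c -> (ccoord c @` cdom c) y ->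
  smooth_at y (fun z => in_chart c a z s).
Proof.
move=> fa cA cy; have [sk|sk] := eqVneq (size s) k.
  case: fa => _ _ _ /(_ c s cA sk) sa; exists (ccoord c @` cdom c); split=> //.
  exact: cimage_open.
apply: (smooth_at_ext (f := fun=> 0)); last exact: smooth_at_cst.
by move=> z; rewrite (in_chart_size _ _ fa).
Qed.

Lemma extd_size P k (a : mform P) p s : is_form k a -> size s != k.+1 -> extd a p s = 0.
Proof.
move=> fa sk; rewrite /extd big1 // => i _.
have sd : size (del i s) != k by rewrite size_del_neq.
have := derive_cst (0 : R^o) (ccoord (chart_at p) p) (nth 0 s i) => H.
rewrite (derive_ext (g := cst 0) (ccoord (chart_at p) p) (nth 0 s i)).
  by rewrite H mulr0.
by move=> y; rewrite (in_chart_size _ _ fa).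
Qed.

(** The degrees may differ, as they do for eta and the moment inside [varpiG]. *)
Lemma extd_sub P k l (a b : mform P) : is_form k a -> is_form l b ->
  extd (a - b) = extd a - extd b.
Proof.
move=> fa fb; apply/funext => p; apply/funext => s.
rewrite -[RHS]/(extd a p s - extd b p s) /extd -sumrB; apply: eq_bigr => i _.
set y := ccoord _ _; set v := nth _ _ _.
have cy : (ccoord (chart_at p) @` cdom (chart_at p)) y.
  by apply: cimage_coord; apply: chart_at_dom.
have da := smooth_at_derivable (v := v) (smooth_at_form (del i s) fa (chart_at_atlas p) cy).
have db := smooth_at_derivable (v := v) (smooth_at_form (del i s) fb (chart_at_atlas p) cy).
by have := deriveB da db => /= H; rewrite -mulrBr -H.
Qed.

Lemma extd_scale (P : manifold R) k (a : mform P) (r : R) : is_form k a ->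
  extd (r *: a) = r *: extd a.
Proof.
move=> fa; apply/funext => p; apply/funext => s.
rewrite -[RHS]/(r * (extd a p s)) /extd mulr_sumr; apply: eq_bigr => i _.
set y := ccoord _ _; set v := nth _ _ _.
have cy : (ccoord (chart_at p) @` cdom (chart_at p)) y.
  by apply: cimage_coord; apply: chart_at_dom.
have da := smooth_at_derivable (v := v) (smooth_at_form (del i s) fa (chart_at_atlas p) cy).
rewrite mulrCA; exact: (congr1 ( *%R ((-1) ^+ i)) (deriveZ r da)).
Qed.

End Forms.

Lemma scaler_addACA (K : pzRingType) (A : lmodType K) (r : K) (a b c d : A) :
  r *: a + b + (r *: c + d) = r *: (a + c) + (b + d).
Proof. by rewrite scalerDr addrACA. Qed.

(** * The invariant trilinear form, eta and the moment as smooth forms *)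

Section CartanForm.
Context {R : realType} (G : lieGroup R).
Implicit Types (g h : G) (u v w x y z : lieAlg G).
Variable ip : lieAlg G -> lieAlg G -> R^o.
Hypotheses (ipP : is_inner_product ip) (ip_inv : Ad_invariant ip).

Definition trip u v w : R := ip u (lie_bracket v w).

Lemma trip_linear1 v w : linear (fun u => trip u v w : R^o).
Proof. exact: ip_linearl ipP _. Qed.

Lemma trip_linear2 u w : linear (fun v => trip u v w : R^o).
Proof.
move=> r x y; rewrite /trip lie_bracket_linearl; exact: ip_linearr ipP _ _ _ _.
Qed.

Lemma trip_linear3 u v : linear (fun w => trip u v w : R^o).
Proof.
move=> r x y; rewrite /trip lie_bracket_linearr; exact: ip_linearr ipP _ _ _ _.
Qed.

Lemma trip_skew23 u v w : trip u v w = - trip u w v.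
Proof.
rewrite /trip [in LHS]lie_bracketC.
exact: (is_linearN (ip_linearr ipP u)).
Qed.

Lemma trip_skew13 u v w : trip u v w = - trip w v u.
Proof.
have H := ip_bracket ipP ip_inv u w v.
apply/eqP; rewrite -addr_eq0 addrC; apply/eqP; rewrite -[RHS]H.
by congr (_ + _); rewrite /trip (ipC ipP).
Qed.

Lemma trip_cycle u v w : trip u v w = trip v w u.
Proof. by rewrite trip_skew13 trip_skew23 opprK trip_skew13 trip_skew23 opprK. Qed.

Lemma trip_Ad g u v w : trip (Ad g u) (Ad g v) (Ad g w) = trip u v w.
Proof. by rewrite /trip -Ad_bracket ip_inv. Qed.

Lemma wedge_bracket_size g s : size s != 2%N ->
  wedge1 (@lie_bracket R G) (@thetaL R G) (form1 (@thetaL R G)) g s = 0.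
Proof.
apply: (@wedge1_size _ _ _ _ _ _ _ _ 1%N 0); first by move=> [|? [|? ?]].
by move=> w; apply: is_linear0 (lie_bracket_linearr w).
Qed.

Lemma wedge_bracketE g u v :
  wedge1 (@lie_bracket R G) (@thetaL R G) (form1 (@thetaL R G)) g [:: u; v] =
  2%:R *: lie_bracket (thetaL g u) (thetaL g v).
Proof.
apply: etrans (wedge1_2 _ _ _ _ _ _) _; rewrite /form1 [X in _ - X]lie_bracketC.
by rewrite opprK scaler_nat mulr2n.
Qed.

Lemma cartan_form_def g s : cartan_form ip g s = 12%:R^-1 * wedge1 ip (@thetaL R G)
  (wedge1 (@lie_bracket R G) (@thetaL R G) (form1 (@thetaL R G))) g s.
Proof. by []. Qed.

Lemma cartan_form_size g s : size s != 3%N -> cartan_form ip g s = 0.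
Proof.
move=> s3; rewrite cartan_form_def -[RHS](mulr0 (12%:R^-1 : R)); congr (_ * _).
apply: (@wedge1_size _ _ _ _ _ _ _ _ 2%N 0) s3; first exact: wedge_bracket_size.
by move=> w; apply: is_linear0 (ip_linearr ipP w).
Qed.

(** Three equal terms, each with the factor 2 of [wedge_bracketE], turn 1/12 into the 1/2 of
    [cartan_formE]. *)
Lemma cyclic_sum (t t' t'' a a' a'' : R) :
  a = 2%:R * t -> a' = 2%:R * t' -> a'' = 2%:R * t'' -> t' = - t -> t'' = t ->
  12%:R^-1 * (a - a' + a'') = 2%:R^-1 * t.
Proof. by move=> -> -> -> -> ->; field. Qed.

Lemma ip_double x y : ip x (2%:R *: y) = 2%:R * ip x y.
Proof. exact: (is_linearZ (ip_linearr ipP x)). Qed.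

Lemma cartan_formE g u v w : cartan_form ip g [:: u; v; w] =
  2%:R^-1 * trip (thetaL g u) (thetaL g v) (thetaL g w).
Proof.
have W a b c := etrans (congr1 (ip (thetaL g a)) (wedge_bracketE g b c))
  (ip_double (thetaL g a) (lie_bracket (thetaL g b) (thetaL g c))).
rewrite cartan_form_def (wedge1_3 ip).
apply: cyclic_sum (W u v w) (W v u w) (W w u v) _ (trip_cycle _ _ _).
exact: etrans (trip_skew23 _ _ _) (congr1 -%R (esym (trip_cycle _ _ _))).
Qed.

Lemma theta_pairing_size x g s : size s != 1%N -> theta_pairing ip x g s = 0.
Proof. by case: s => [|? [|??]]. Qed.

Lemma theta_pairing_scale r x : theta_pairing ip (r *: x) = r *: theta_pairing ip x.
Proof.
apply/funext => g; apply/funext => s; rewrite -[RHS]/(r *: (theta_pairing ip x g s : R^o)).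
have [|s1] := eqVneq (size s) 1%N; last by rewrite !theta_pairing_size // scaler0.
case: s => [|v [|??]] //= _; exact: (is_linearZ (ip_linearr ipP _)).
Qed.

Lemma smooth_at_ip (V : normedModType R) (t : V) (a b : V -> lieAlg G) :
  smooth_at t (a : V -> 'rV[R]_(mdim G)) -> smooth_at t (b : V -> 'rV[R]_(mdim G)) ->
  smooth_at t (fun r => ip (a r) (b r)).
Proof. exact: smooth_at_bilinear (ip_linearl ipP) (ip_linearr ipP). Qed.

Lemma theta_pairing_form x : is_form 1 (theta_pairing ip x).
Proof.
split.
- by move=> g s; apply: theta_pairing_size.
- move=> g [|??] // [|??] // r u v _.
  rewrite /= /theta_pairing /form1 thetaL_linear thetaR_linear.
  have -> : r *: thetaL g u + thetaL g v + (r *: thetaR g u + thetaR g v) =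
     r *: (thetaL g u + thetaR g u) + (thetaL g v + thetaR g v).
    exact: scaler_addACA.
  exact: ip_linearl.
- move=> g s1 s2 s3 u; apply: theta_pairing_size.
  by rewrite size_cat /= size_cat /= !addnS.
move=> c [|v [|??]] // cA _; apply: smooth_at_on => y cy.
have sc := msmooth_at_param cA cy.
apply: smooth_at_ip (smooth_at_cst _ _).
exact: smooth_atD (smooth_at_pullL (fin_dim_rV _) v sc)
  (smooth_at_pullR (fin_dim_rV _) v sc).
Qed.

Lemma cartan_form_form : is_form 3 (cartan_form ip).
Proof.
have trip0 (a b : lieAlg G) : trip b a a = 0.
  by have := trip_skew23 b a a; lra.
have trip1 (a b : lieAlg G) : trip a b a = 0 by rewrite trip_cycle.
have trip2 (a b : lieAlg G) : trip a a b = 0 by rewrite trip_cycle.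
split.
- by move=> g s; apply: cartan_form_size.
- move=> g s1 s2 r u v; rewrite -addSn.
  case: s1 => [|a [|b [|? ?]]]; case: s2 => [|a' [|b' [|? ?]]] //= _;
    rewrite !cartan_formE thetaL_linear.
  + rewrite (trip_linear1 _ _ r (thetaL g u)) mulrDr [X in X + _]mulrCA //.
  + rewrite (trip_linear2 _ _ r (thetaL g u)) mulrDr [X in X + _]mulrCA //.
  + rewrite (trip_linear3 _ _ r (thetaL g u)) mulrDr [X in X + _]mulrCA //.
- move=> g s1 s2 s3 u.
  have [|s3'] := eqVneq (size (s1 ++ u :: s2 ++ u :: s3)) 3%N; last exact: cartan_form_size.
  rewrite size_cat /= size_cat /= !addnS => sz.
  case: s1 s2 s3 sz => [|a [|a' s1]] [|b [|b' s2]] [|d [|d' s3]];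
    rewrite /= ?addnS ?addSn //= => _;
    by rewrite cartan_formE ?trip0 ?trip1 ?trip2 mulr0.
move=> c [|u [|v [|w [|? ?]]]] // cA _; apply: smooth_at_on => y cy.
have sc := msmooth_at_param cA cy; have fV := fin_dim_rV (R := R) (mdim G).
have su z := smooth_at_pullL fV z sc.
have : smooth_at y (fun r => (2%:R^-1 : R^o) *:
    (ip (pullL (cparam c) u r) (lie_bracket (pullL (cparam c) v r) (pullL (cparam c) w r)))).
  apply: smooth_at_scale; first exact: smooth_at_cst.
  apply: smooth_at_ip (su u) _.
  exact: smooth_at_bilinear (@lie_bracket_linearl R G) (@lie_bracket_linearr R G) (su v) (su w).
by apply: smooth_at_ext => r; rewrite in_chartE /= cartan_formE.
Qed.

End CartanForm.

(** * The algebra of d eta = 0 *)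

Section AlternatingForm.
Context {R : realType}.

Lemma jacobi_sum (p q r p' q' q'' r' : R) : p = p' -> q = q' -> r = r' ->
  q' = - q'' -> p' + q'' + r' = 0 -> p - q + r = 0.
Proof. by move=> -> -> -> ->; rewrite opprK. Qed.

(** [tij] is the term in which the derivative along the i-th vector falls on [thetaL] of the j-th.
    The twelve terms form six pairs {i, j}, and complementary pairs contribute equally because both
    give the inner product of the same two brackets. The total is -(p - q + r), the Jacobi
    expression up to sign. *)
Lemma alternating_sum (t12 t13 t14 t21 t23 t24 t31 t32 t34 t41 t42 t43 p q r : R) :
  t12 - t21 = - p -> t13 + t31 = q -> t14 - t41 = - r -> - t23 + t32 = - r ->
  - t24 - t42 = q -> t34 - t43 = - p -> p - q + r = 0 ->
  2%:R^-1 * (t12 + t13 + t14) - 2%:R^-1 * (t21 + t23 + t24) +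
  2%:R^-1 * (t31 + t32 + t34) - 2%:R^-1 * (t41 + t42 + t43) = 0.
Proof. lra. Qed.

Context {A : Type} (br : A -> A -> A) (T : A -> A -> A -> R).
Hypotheses (C : forall x y z, T x y z = T y z x)
  (S : forall x y z, T x y z = - T x z y)
  (B : forall x y z w, T (br x y) z w = T (br z w) x y).

(* Here a, b, c, d stand for the values of thetaL at four vectors and dab for the
   derivative along the first of thetaL at the second, extended constantly. *)
Lemma alternating_form (a b c d dab dac dad dba dbc dbd dca dcb dcd dda ddb ddc : A) :
  (forall v w, T dab v w - T dba v w = - T (br a b) v w) ->
  (forall v w, T dac v w - T dca v w = - T (br a c) v w) ->
  (forall v w, T dad v w - T dda v w = - T (br a d) v w) ->
  (forall v w, T dbc v w - T dcb v w = - T (br b c) v w) ->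
  (forall v w, T dbd v w - T ddb v w = - T (br b d) v w) ->
  (forall v w, T dcd v w - T ddc v w = - T (br c d) v w) ->
  T (br a b) c d - T (br a c) b d + T (br a d) b c = 0 ->
  2%:R^-1 * (T dab c d + T b dac d + T b c dad) -
  2%:R^-1 * (T dba c d + T a dbc d + T a c dbd) +
  2%:R^-1 * (T dca b d + T a dcb d + T a b dcd) -
  2%:R^-1 * (T dda b c + T a ddb c + T a b ddc) = 0.
Proof.
move=> eab eac ead ebc ebd ecd J.
apply: (alternating_sum (p := T (br a b) c d) (q := T (br a c) b d)
  (r := T (br a d) b c)) J.
- exact: eab.
- by have := eac b d; rewrite (C b dac) (S dac d b); lra.
- by have := ead b c; rewrite (C dad b c).
- by have := ebc d a; rewrite (C a dbc) (C a dcb) (S (br b c) d a) (B b c a d); lra.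
- have := ebd a c; rewrite -(C dbd a c) (C a ddb) (S ddb c a) -(B a c b d).
  by lra.
- by have := ecd a b; rewrite (C dcd a b) (C ddc a b) (B c d).
Qed.

End AlternatingForm.

Lemma sum4_eq0 (A : zmodType) (x1 x2 x3 x4 y1 y2 y3 y4 : A) :
  x1 = y1 -> x2 = y2 -> x3 = y3 -> x4 = y4 ->
  y1 - y2 + y3 - y4 = 0 -> x1 - x2 + x3 - x4 = 0.
Proof. by move=> -> -> -> ->. Qed.

Lemma sum_diff (A : zmodType) (a a' b b' c c' : A) :
  a - a' = - c -> b - b' = c' -> a + b - (a' + b') = c' - c.
Proof. by move=> E E'; rewrite opprD addrACA E E' addrC. Qed.

Lemma alternating_signs (A : comPzRingType) (x1 x2 x3 x4 : A) :
  (-1) ^+ 0 * x1 + ((-1) ^+ 1 * x2 + ((-1) ^+ 2 * x3 + ((-1) ^+ 3 * x4 + 0))) =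
  x1 - x2 + x3 - x4.
Proof. by rewrite !exprS expr0; ring. Qed.

Section ExtdEval.
Context {R : realType} (P : manifold R) (a : mform P) (p : P).

Notation dchart v s :=
  ('D_v (fun y => in_chart (chart_at p) a y s) (ccoord (chart_at p) p)).

Lemma extd_2 u v : extd a p [:: u; v] = dchart u [:: v] - dchart v [:: u].
Proof.
rewrite /extd !big_ord_recl big_ord0 /= /del /=.
by rewrite expr0 expr1 mul1r mulN1r addr0.
Qed.

Lemma extd_4 u v w z : extd a p [:: u; v; w; z] =
  dchart u [:: v; w; z] - dchart v [:: u; w; z] +
  dchart w [:: u; v; z] - dchart z [:: u; v; w].
Proof.
rewrite /extd !big_ord_recl big_ord0 /= /del /=.
exact: alternating_signs.
Qed.

End ExtdEval.

(** * Exterior derivatives and contractions of eta and of the moment *)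

Section Closed.
Context {R : realType} (G : lieGroup R).
Implicit Types (g h : G) (u v w x y z : lieAlg G).
Variable ip : lieAlg G -> lieAlg G -> R^o.
Hypotheses (ipP : is_inner_product ip) (ip_inv : Ad_invariant ip).

Notation T := (trip ip).

Lemma trip_diff u u' a b v w : u - u' = - lie_bracket a b ->
  T u v w - T u' v w = - T (lie_bracket a b) v w.
Proof.
move=> E; have H := is_linearB (trip_linear1 ipP v w) u u'; rewrite E in H.
have H' := is_linearN (trip_linear1 ipP v w) (lie_bracket a b).
exact: etrans (esym H) H'.
Qed.

Lemma trip_bracket x y z w : T (lie_bracket x y) z w = T (lie_bracket z w) x y.
Proof. exact: (ipC ipP). Qed.

(** By symmetry and cyclicity, <[a, b], [c, d]> = <a, [b, [c, d]]>, so the sum is a paired with the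
    Jacobi identity for b, c, d. *)
Lemma trip_jacobi a b c d : T (lie_bracket a b) c d - T (lie_bracket a c) b d +
  T (lie_bracket a d) b c = 0.
Proof.
have M x y z w : T (lie_bracket x y) z w = T x y (lie_bracket z w).
  by rewrite trip_bracket (trip_cycle ipP ip_inv).
have J := congr1 (ip a) (jacobi b c d).
rewrite !(is_linearD (ip_linearr ipP a)) (is_linear0 (ip_linearr ipP a)) in J.
have N := congr1 (ip a) (congr1 (lie_bracket c) (lie_bracketC b d)).
rewrite (is_linearN (lie_bracket_linearr c)) (is_linearN (ip_linearr ipP a)) in N.
have {}N : T a c (lie_bracket b d) = - T a c (lie_bracket d b) := N.
have {}J : T a b (lie_bracket c d) + T a c (lie_bracket d b) +
  T a d (lie_bracket b c) = 0 := J.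
exact: jacobi_sum (M a b c d) (M a c b d) (M a d b c) N J.
Qed.

Lemma closed_alg (a b c d dab dac dad dba dbc dbd dca dcb dcd dda ddb ddc : lieAlg G) :
  dab - dba = - lie_bracket a b -> dac - dca = - lie_bracket a c ->
  dad - dda = - lie_bracket a d -> dbc - dcb = - lie_bracket b c ->
  dbd - ddb = - lie_bracket b d -> dcd - ddc = - lie_bracket c d ->
  2%:R^-1 * (T dab c d + T b dac d + T b c dad) -
  2%:R^-1 * (T dba c d + T a dbc d + T a c dbd) +
  2%:R^-1 * (T dca b d + T a dcb d + T a b dcd) -
  2%:R^-1 * (T dda b c + T a ddb c + T a b ddc) = 0.
Proof.
move=> /trip_diff eab /trip_diff eac /trip_diff ead /trip_diff ebc /trip_diff ebd
  /trip_diff ecd.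
exact: (alternating_form (trip_cycle ipP ip_inv) (trip_skew23 ipP) trip_bracket
  eab eac ead ebc ebd ecd (trip_jacobi a b c d)).
Qed.

Lemma derive_trip (V : normedModType R) (t s : V) (f1 f2 f3 : V -> 'rV[R]_(mdim G)) :
  smooth_at t f1 -> smooth_at t f2 -> smooth_at t f3 ->
  'D_s (fun r => 2%:R^-1 * T (f1 r) (f2 r) (f3 r) : R^o) t =
  2%:R^-1 * (T ('D_s f1 t) (f2 t) (f3 t) + T (f1 t) ('D_s f2 t) (f3 t) +
             T (f1 t) (f2 t) ('D_s f3 t)).
Proof.
move=> s1 s2 s3.
have Bl := @lie_bracket_linearl R G; have Br := @lie_bracket_linearr R G.
have sb := smooth_at_bilinear Bl Br s2 s3.
have sT := smooth_at_ip ipP s1 sb.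
have d1 := smooth_at_differentiable s1; have d2 := smooth_at_differentiable s2.
have d3 := smooth_at_differentiable s3.
have H := deriveZ (2%:R^-1 : R) (smooth_at_derivable (v := s) sT).
apply: etrans H _; congr (_ * _).
have H1 := derive_bilinear s (ip_linearl ipP) (ip_linearr ipP) d1
  (smooth_at_differentiable sb).
have H2 := derive_bilinear s Bl Br d2 d3.
apply: etrans H1 _; rewrite -addrA; congr (_ + _).
exact: etrans (congr1 (ip (f1 t)) H2) (is_linearD (ip_linearr ipP (f1 t)) _ _).
Qed.

Lemma pullL_smooth g s :
  smooth_at (ccoord (chart_at g) g) (pullL (cparam (chart_at g)) s).
Proof.
exact: (smooth_at_pullL (fin_dim_rV _) s (msmooth_at_param_at g)).
Qed.

Lemma cartan_form_in_chart (c : chart R G (mdim G)) t u v w :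
  in_chart c (cartan_form ip) t [:: u; v; w] =
  2%:R^-1 * T (pullL (cparam c) u t) (pullL (cparam c) v t) (pullL (cparam c) w t).
Proof. by rewrite in_chartE /= cartan_formE. Qed.

Lemma extd_cartan_form : extd (cartan_form ip) = 0.
Proof.
apply/funext => g; apply/funext => s; rewrite -[RHS]/(0 : R).
have [s4|] := eqVneq (size s) 4%N; last exact: extd_size (cartan_form_form ipP ip_inv).
case: s s4 => [|a [|b [|c [|d [|? ?]]]]] // _.
pose D r r' := 'D_r (pullL (cparam (chart_at g)) r') (ccoord (chart_at g) g).
pose th r := pullL (cparam (chart_at g)) r (ccoord (chart_at g) g).
have MC r r' : D r r' - D r' r = - lie_bracket (th r) (th r').
  exact: (maurer_cartanL (fin_dim_rV _) r r' (msmooth_at_param_at g)).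
have E r u v w : 'D_r (fun y => in_chart (chart_at g) (cartan_form ip) y [:: u; v; w])
   (ccoord (chart_at g) g) = 2%:R^-1 * (T (D r u) (th v) (th w) +
   T (th u) (D r v) (th w) + T (th u) (th v) (D r w)).
  rewrite (derive_ext _ _ (fun t => cartan_form_in_chart (chart_at g) t u v w)).
  by apply: derive_trip; apply: pullL_smooth.
rewrite extd_4.
exact: sum4_eq0 (E a b c d) (E b a c d) (E c a b d) (E d a b c)
  (closed_alg (MC a b) (MC a c) (MC a d) (MC b c) (MC b d) (MC c d)).
Qed.

Lemma theta_pairing_in_chart x (c : chart R G (mdim G)) t u :
  in_chart c (theta_pairing ip x) t [:: u] =
  ip (pullL (cparam c) u t + pullR (cparam c) u t) x.
Proof. by []. Qed.

(** The two Maurer-Cartan equations give Ad_g of the bracket minus the bracket, and invariance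
    transfers Ad_g to x as Ad_(g^-1). The first argument is then minus [thetaL] of the fundamental
    field, which is what [iprod_cartan_form] needs. *)
Lemma extd_theta_pairing x g u v : extd (theta_pairing ip x) g [:: u; v] =
  ip (Ad (ginv g) x - x) (lie_bracket (thetaL g u) (thetaL g v)).
Proof.
rewrite extd_2.
set y0 := ccoord (chart_at g) g; set c := cparam (chart_at g).
have sc : msmooth_at y0 c by apply: msmooth_at_param_at.
have fV := fin_dim_rV (R := R) (mdim G).
pose D (f : 'rV[R]_(mdim G) -> _) r : 'rV[R]_(mdim G) := 'D_r f y0.
have E r w : 'D_r (fun y => in_chart (chart_at g) (theta_pairing ip x) y [:: w]) y0 =
   ip (D (pullL c w) r + D (pullR c w) r) x.
  have sL := smooth_at_pullL fV w sc; have sR := smooth_at_pullR fV w sc.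
  have sLR := smooth_atD sL sR.
  apply: etrans (derive_ext _ _ (fun t => theta_pairing_in_chart x (chart_at g) t w)) _.
  have lx := ip_linearl ipP x.
  apply: etrans (derive_linear_comp r lx (rV_linear_cont lx)
    (smooth_at_differentiable sLR)) _.
  exact: (congr1 (ip^~ x)
    (deriveD (smooth_at_derivable (v := r) sL) (smooth_at_derivable (v := r) sR))).
have ML := maurer_cartanL fV u v sc; have MR := maurer_cartanR fV u v sc.
have cg : c y0 = g by apply: param_coord.
have th r : pullL c r y0 = thetaL g r.
  apply: etrans (congr1 (fun h => thetaL h (mderiv c y0 r)) cg) _.
  exact: (congr1 (thetaL g) (mderiv_param g r)).
rewrite cg !th in ML MR.
apply: etrans (congr2 (fun a b => a - b) (E u v) (E v u)) _.
apply: etrans (esym (is_linearB (ip_linearl ipP x) _ _)) _.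
have EE : D (pullL c v) u + D (pullR c v) u - (D (pullL c u) v + D (pullR c u) v) =
  Ad g (lie_bracket (thetaL g u) (thetaL g v)) - lie_bracket (thetaL g u) (thetaL g v).
  exact: sum_diff ML MR.
apply: etrans (congr1 (ip^~ x) EE) _.
rewrite (is_linearB (ip_linearl ipP x)) (is_linearB (ip_linearl ipP _)).
by rewrite (ip_Ad_adjoint ip_inv) (ipC ipP _ x) [in X in X - _](ipC ipP).
Qed.

Lemma iprod_cartan_form (expG : lieAlg G -> G) x : is_exponential expG ->
  iprod (fundamental_field expG (@conjG R G) x) (cartan_form ip) =
  - ((2%:R^-1 : R) *: extd (theta_pairing ip x)).
Proof.
move=> expP; apply/funext => g; apply/funext => s.
have fT := theta_pairing_form ipP x.
rewrite -[LHS]/(cartan_form ip g (_ :: s)).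
rewrite -[RHS]/(- (2%:R^-1 * (extd (theta_pairing ip x) g s : R))).
have [|s2] := eqVneq (size s) 2%N; last first.
  by rewrite (extd_size _ fT) // mulr0 oppr0 cartan_form_size.
case: s => [|u [|v [|? ?]]] // _.
rewrite cartan_formE // extd_theta_pairing thetaL_fundamental_conj //.
rewrite -mulrN -(is_linearN (ip_linearl ipP _)) opprB.
by [].
Qed.

(** On the fundamental field [thetaL] and [thetaR] add up to Ad_g x - Ad_(g^-1) x, and Ad_g and
    Ad_(g^-1) are adjoint, so the pairing with x cancels. *)
Lemma iprod_theta_pairing (expG : lieAlg G -> G) x : is_exponential expG ->
  iprod (fundamental_field expG (@conjG R G) x) (theta_pairing ip x) = 0.
Proof.
move=> expP; apply/funext => g; apply/funext => s; rewrite -[RHS]/(0 : R).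
case: s => [|? ?] //; rewrite -[LHS]/(ip (thetaL g _ + thetaR g _) x).
rewrite thetaL_fundamental_conj // thetaR_fundamental_conj //.
rewrite addrC subrKA.
apply: etrans (is_linearB (ip_linearl ipP x) _ _) _.
by rewrite (ip_Ad_adjoint ip_inv) (ipC ipP) subrr.
Qed.

End Closed.

Lemma congr3 (A B : Type) (f : A -> A -> A -> B) a b c a' b' c' :
  a = a' -> b = b' -> c = c' -> f a b c = f a' b' c'.
Proof. by move=> -> -> ->. Qed.

Lemma size3_seq (A : Type) (s : seq A) : size s = 3%N ->
  exists u v w, s = [:: u; v; w].
Proof. by case: s => [|u [|v [|w [|? ?]]]] // _; exists u, v, w. Qed.

(** * The Cartan model *)

Section CartanModel.
Context {R : realType} (G : lieGroup R).
Implicit Types (g h : G) (u v w x y z : lieAlg G).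
Variable ip : lieAlg G -> lieAlg G -> R^o.
Hypotheses (ipP : is_inner_product ip) (ip_inv : Ad_invariant ip).

Lemma cartan_form_conj g : pullback (conjG g) (cartan_form ip) = cartan_form ip.
Proof.
apply/funext => h; apply/funext => s.
rewrite -[LHS]/(cartan_form ip (conjG g h) (map (tangent_map (conjG g) h) s)).
have [|s3] := eqVneq (size s) 3%N; last by rewrite !cartan_form_size ?size_map.
move=> /size3_seq [u [v [w ->]]].
apply: etrans (cartan_formE ipP ip_inv _ _ _ _) _.
apply: etrans (congr1 ( *%R 2%:R^-1) _) (esym (cartan_formE ipP ip_inv h u v w)).
apply: etrans _ (trip_Ad ip_inv g _ _ _).
by apply: (congr3 (trip ip)); apply: thetaL_conj.
Qed.

Lemma theta_pairing_conj g x :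
  pullback (conjG g) (theta_pairing ip (Ad g x)) = theta_pairing ip x.
Proof.
apply/funext => h; apply/funext => s.
case: s => [|u [|? ?]] //.
rewrite -[LHS]/(ip (thetaL (conjG g h) (tangent_map (conjG g) h u) +
   thetaR (conjG g h) (tangent_map (conjG g) h u)) (Ad g x)).
by rewrite thetaL_conj thetaR_conj -(is_linearD (Ad_linear g)) ip_inv.
Qed.

(** With the scalar inside the argument, [theta_pairing_poly] and [theta_pairing_equivariant] serve
    both the moment (r = 1/2) and the linear part of [varpiG] (r = -1/2). *)
Lemma momentE (M : manifold R) x :
  (moment M ip).1 x = theta_pairing ip ((2%:R^-1 : R) *: x).
Proof. by rewrite theta_pairing_scale. Qed.

Lemma coord_lin_ex (j : 'I_(mdim G)) :
  exists L : {linear lieAlg G -> R^o}, forall x, L x = (x : 'rV[R]_(mdim G)) 0 j.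
Proof.
have lin : linear (fun x : lieAlg G => (x : 'rV[R]_(mdim G)) 0 j : R^o).
  exact: coord_linear.
by have [L EL] := linear_pack lin; exists L => x; rewrite -EL.
Qed.

Lemma theta_pairing_poly (r : R) :
  poly_form 1 1 (fun x => theta_pairing ip (r *: x)).
Proof.
have [L EL] := choice coord_lin_ex.
(* Coordinate functionals on g, with the moment at the corresponding basis vectors as coefficient
   forms. *)
exists (mdim G), (fun j _ => L j), (fun j => theta_pairing ip (r *: delta_mx 0 j)).
split=> [j|x]; first exact: theta_pairing_form.
rewrite theta_pairing_scale //; apply/funext => g; apply/funext => s.
rewrite fct_sumE fct_sumE.
under eq_bigr do rewrite big_ord1 EL theta_pairing_scale //.
have [|s1] := eqVneq (size s) 1%N; last first.
  rewrite -[LHS]/(r * theta_pairing ip x g s) theta_pairing_size // mulr0 big1 // => j _.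
  rewrite -[LHS]/(_ * (r * theta_pairing ip _ g s)) theta_pairing_size //.
  by rewrite !mulr0.
case: s => [|u [|? ?]] // _.
rewrite -[LHS]/(r * ip (thetaL g u + thetaR g u) x).
have := family_sum x (ip_linearr ipP (thetaL g u + thetaR g u)) => ->.
rewrite mulr_sumr; apply: eq_bigr => j _; exact: mulrCA.
Qed.

Lemma theta_pairing_equivariant (r : R) :
  equivariant_cochain (@conjG R G) (fun x => theta_pairing ip (r *: x)).
Proof.
by move=> g x; rewrite -(is_linearZ (Ad_linear g)) theta_pairing_conj.
Qed.

Lemma poly_form0 (P : manifold R) q (a : mform P) : is_form q a ->
  poly_form 0 q (fun=> a : mform P) (G := G).
Proof.
(* [L] merely inhabits the type of linear functionals: for p = 0 the product of functionals is empty
   and equals 1. *)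
have [L _] := linear_pack (@zero_is_linear R (lieAlg G) R^o).
move=> fa; exists 1%N, (fun _ _ => L), (fun=> a); split=> // x.
by rewrite big_ord1 big_ord0 scale1r.
Qed.

Lemma poly_form_zero (P : manifold R) p q : poly_form p q (0 : cochain G P).
Proof.
have [L _] := linear_pack (@zero_is_linear R (lieAlg G) R^o).
exists 0%N, (fun _ _ => L), (fun=> 0); split=> [[]//|x].
by rewrite big_ord0.
Qed.

Lemma equivariant_zero (P : manifold R) (act : G -> P -> P) :
  equivariant_cochain act (0 : cochain G P).
Proof. by []. Qed.

Lemma cartan_cochain_eta : cartan_cochain (@conjG R G) 3
  ((fun=> cartan_form ip : mform G) - (moment G ip).1).
Proof.
exists (fun p => match p with
  | 0%N => fun=> cartan_form ip
  | 1%N => fun x => theta_pairing ip ((- 2%:R^-1 : R) *: x)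
  | _ => 0 end); split.
- move=> [|[|p]] // _; split.
  + exact/poly_form0/cartan_form_form.
  + by move=> g x; apply: cartan_form_conj.
  + exact: theta_pairing_poly.
  + exact: theta_pairing_equivariant.
- rewrite !big_ord_recl big_ord0 addr0 /=.
  apply/funext => x; rewrite -[LHS]/(cartan_form ip - (moment G ip).1 x).
  rewrite -[RHS]/(cartan_form ip + theta_pairing ip _) momentE.
  by rewrite !theta_pairing_scale // scaleNr.
Qed.

Lemma cartan_cochain_omega (M : manifold R) (act : G -> M -> M) (omega : mform M) :
  is_form 2 omega -> (forall g, pullback (act g) omega = omega) ->
  cartan_cochain act 2 (fun=> omega : mform M).
Proof.
move=> fo io; exists (fun p => if p is 0%N then fun=> omega else 0); split.
- move=> [|[|p]] // _; split.
  + exact: poly_form0.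
  + by move=> g x; apply: io.
  + exact: poly_form_zero.
  + exact: equivariant_zero.
- by rewrite !big_ord_recl big_ord0 /= !addr0.
Qed.

Lemma extdG_eta (expG : lieAlg G -> G) : is_exponential expG ->
  extdG expG (@conjG R G) ((fun=> cartan_form ip : mform G) - (moment G ip).1) = 0.
Proof.
move=> expP; apply/funext => x.
rewrite /extdG -[(_ - _) x]/(cartan_form ip - (2%:R^-1 : R) *: theta_pairing ip x).
have fT : is_form 1 ((2%:R^-1 : R) *: theta_pairing ip x).
  by rewrite -theta_pairing_scale //; apply: theta_pairing_form.
rewrite (extd_sub (cartan_form_form ipP ip_inv) fT) (extd_cartan_form ipP ip_inv).
rewrite (extd_scale _ (theta_pairing_form ipP x)) sub0r.
set F := fundamental_field _ _ _.
have -> : iprod F (cartan_form ip - (2%:R^-1 : R) *: theta_pairing ip x) =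
   iprod F (cartan_form ip) - (2%:R^-1 : R) *: iprod F (theta_pairing ip x) by [].
rewrite (iprod_cartan_form ipP ip_inv) // (iprod_theta_pairing ipP ip_inv) //.
by rewrite scaler0 subr0 subrr.
Qed.

End CartanModel.

Theorem theorem8p4 (R : realType) (G : lieGroup R)
    (G_compact : compact [set: G]) (G_connected : connected [set: G])
    (expG : lieAlg G -> G) (expGP : is_exponential expG)
    (ip : lieAlg G -> lieAlg G -> R^o)
    (ipP : is_inner_product ip) (ip_inv : Ad_invariant ip)
    (M : manifold R) (act : G -> M -> M) (actP : smooth_action act)
    (omega : mform M) (omega_form : is_form 2 omega)
    (omega_inv : forall g, pullback (act g) omega = omega)
    (mu : M -> G) (mu_smooth : smooth mu)
    (mu_equiv : forall g p, mu (act g p) = conjG g (mu p)) :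
  let eta := cartan_form ip in
  let varpi := (eta, omega) in
  let varpiG := const_cochain varpi - moment M ip in
  let QH1 := extd omega = pullback mu eta in
  let QH2 := forall x : lieAlg G,
    iprod (fundamental_field expG act x) omega =
    (2%:R^-1 : R) *: pullback mu (theta_pairing ip x) in
  (QH1 /\ QH2 <-> one_step_extension expG act mu varpi varpiG) /\
  (QH1 /\ QH2 <-> rel_extdG expG act mu varpiG = 0).
Proof.
move=> eta varpi varpiG QH1 QH2.
have ef : is_form 3 eta := cartan_form_form ipP ip_inv.
have rel1 : (rel_extdG expG act mu varpiG).1 = 0 := extdG_eta ipP ip_inv expGP.
have mE : (moment M ip).1 = fun x => theta_pairing ip ((2%:R^-1 : R) *: x).
  by apply/funext => x; apply: momentE.
have e2 : varpiG.2 = fun=> omega by rewrite /varpiG /= subr0.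
have rel2 x p s : (rel_extdG expG act mu varpiG).2 x p s =
    pullback mu eta p s - 2%:R^-1 * pullback mu (theta_pairing ip x) p s -
    (extd omega p s - iprod (fundamental_field expG act x) omega p s).
  rewrite -[LHS]/(pullback mu (varpiG.1 x) p s - (extd (varpiG.2 x) p s -
    iprod (fundamental_field expG act x) (varpiG.2 x) p s)) e2.
  by [].
have iff0 : QH1 /\ QH2 <-> rel_extdG expG act mu varpiG = 0.
  split=> [[q1 q2]|E0].
    rewrite [LHS]surjective_pairing rel1; congr (_, _).
    apply/funext => x; apply/funext => p; apply/funext => s.
    rewrite rel2 q1 q2 -[X in _ - (_ - X)]/(2%:R^-1 * pullback mu (theta_pairing ip x) p s).
    exact: subrr.
  have E x p s : pullback mu eta p s - 2%:R^-1 * pullback mu (theta_pairing ip x) p s -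
    (extd omega p s - iprod (fundamental_field expG act x) omega p s) = 0 :> R.
    by rewrite -rel2 E0.
  split.
    apply/funext => p; apply/funext => s.
    have [s3|s3] := eqVneq (size s) 3%N; last first.
      by rewrite (extd_size _ omega_form) // /pullback (form_size _ ef) ?size_map.
    (* Any x would serve: on three vectors the pairing vanishes by degree, and the contraction would
       evaluate the 2-form [omega] on four. *)
    have := E 0 p s; rewrite /pullback theta_pairing_size ?size_map ?s3 //.
    rewrite /iprod (form_size (s := _ :: s) _ omega_form) /= ?s3 //.
    rewrite mulr0 !subr0 => /eqP; rewrite subr_eq0 => /eqP ->.
    by [].
  move=> x; apply/funext => p; apply/funext => s.
  rewrite -[RHS]/(2%:R^-1 * pullback mu (theta_pairing ip x) p s).
  have [s1|s1] := eqVneq (size s) 1%N; last first.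
    rewrite /iprod (form_size (s := _ :: s) _ omega_form) //.
    by rewrite /pullback theta_pairing_size ?size_map // mulr0.
  (* On one vector the 3-forms [pullback mu eta] and [extd omega] vanish, which leaves the moment
     and the contraction. *)
  have := E x p s; rewrite {1}/pullback (form_size _ ef) ?size_map ?s1 //.
  rewrite (extd_size _ omega_form) ?s1 // !sub0r opprK addrC => /eqP.
  by rewrite subr_eq0 => /eqP.
split; last exact: iff0.
rewrite iff0; split=> [E|[]//]; split=> //.
- exists (moment M ip); split=> //; split.
  + by rewrite mE; apply: theta_pairing_poly.
  + by rewrite mE; apply: theta_pairing_equivariant.
  + exact: poly_form_zero.
  + exact: equivariant_zero.
- split; first exact: cartan_cochain_eta.
  by rewrite e2; apply: cartan_cochain_omega.
Qed.
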